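(* Let $k$ be an arbitrary field and let $H=\langle a_1,a_2,a_3\rangle$ be a numerical semigroup of embedding dimension three and multiplicity three or four, with minimal generators $a_1,a_2,a_3$. Let $S=k[x_1,x_2,x_3]$, let $\ell$ be the least weighted degree of a nonzero homogeneous element of the defining ideal $\mathfrak p_H\subseteq S$ of $k[H]$, and let $I_{\ell+1}\subseteq S$ be the inverse image of $t^{\ell+1}k[t]\cap k[H]$ (see context). Consider the following two forms of ideals in $k[x,y,z]$: (F1) $(y^2-x^{b-d}z,\ x^{2b+2-e},\ x^{b+1}y,\ x^{b-d+1}z,\ yz,\ z^2)$ with integers $b>d\geq 0$ and $e\in\{0,1\}$; (F2) $(y^2-x^{2b+1},\ x^{2b+2},\ x^{b+1}y,\ x^{r}z,\ yz,\ z^2)$ with integers $b\geq 1$ and $1\leq r\leq b+1$. Here $x,y,z$ stand for a suitable ordering of $x_1,x_2,x_3$. Then: (1) If $H$ has multiplicity three, then, after a possible interchange of variables, $I_{\ell+1}$ is of the form (F1). (2) If $H$ is symmetric of multiplicity four (equivalently, if $H$ has multiplicity four and $k[H]$ is Gorenstein), then, after a possible interchange of variables, either $I_{\ell+1}=(x_3)+JS$ for an integrally closed $(x_1,x_2)$-primary ideal $J\subseteq k[x_1,x_2]$, or $I_{\ell+1}$ is of the form (F1) or (F2). (3) If $H$ is non-symmetric of multiplicity four, then $I_{\ell+1}$ is minimally generated by seven elements. (4) Conversely, for every choice of the parameters $(b,d,e)$ in (F1), the corresponding ideal is realized as $I_{\ell+1}$ (up to naming of the variables) by some numerical semigroup of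 embedding dimension three and multiplicity three; and for every choice of the parameters $(b,r)$ in (F2), the corresponding ideal is realized as $I_{\ell+1}$ (up to naming of the variables) by some symmetric numerical semigroup of embedding dimension three and multiplicity four.
   Context: A numerical semigroup is a submonoid $H$ of $\mathbb N=\{0,1,2,\dots\}$ with $\mathbb N\setminus H$ finite. Its multiplicity is its least positive element, and its embedding dimension is the cardinality of its unique minimal system of generators; $\langle a_1,a_2,a_3\rangle$ denotes the submonoid generated by $a_1,a_2,a_3$. The Frobenius number is $\mathrm F(H)=\max(\mathbb Z\setminus H)$, and $H$ is symmetric if, for every integer $a$, $a\in H$ if and only if $\mathrm F(H)-a\notin H$. The semigroup ring is $k[H]=k[t^{h}\mid h\in H]\subseteq k[t]$. For $H=\langle a_1,a_2,a_3\rangle$ of embedding dimension three, $S=k[x_1,x_2,x_3]$ is graded by $\deg x_i=a_i$, $\varphi_H\colon S\to k[H]$ is the $k$-algebra map with $\varphi_H(x_i)=t^{a_i}$, and $\mathfrak p_H=\operatorname{Ker}\varphi_H$ is the defining ideal. For $h\in\mathbb N$, $I_h=\varphi_H^{-1}\bigl(t^hk[t]\cap k[H]\bigr)$. *)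

(* Defs.v *)
From HB Require Import structures.
From mathcomp Require Import all_boot all_order all_fingroup all_algebra.
From mathcomp.multinomials Require Import mpoly.

Set Implicit Arguments.
Unset Strict Implicit.
Unset Printing Implicit Defensive.

Import GRing.Theory.
Local Open Scope ring_scope.

Section NumericalSemigroups.
Local Open Scope nat_scope.

Definition submonoid_span (A : seq nat) (n : nat) : Prop :=
  exists c : nat -> nat, n = \sum_(a <- A) c a * a.

Definition numerical_semigroup (H : nat -> Prop) : Prop :=
  [/\ H 0, forall m n, H m -> H n -> H (m + n)
    & exists N, forall n, N <= n -> H n].

Definition generates (A : seq nat) (H : nat -> Prop) : Prop :=
  forall n, H n <-> submonoid_span A n.

(* The embedding dimension of [H] is the size of any such [A]. *)
Definition minimal_generators (H : nat -> Prop) (A : seq nat) : Prop :=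
  [/\ uniq A, generates A H
    & forall B : seq nat,
        {subset B <= A} -> generates B H -> {subset A <= B}].

Definition multiplicity (H : nat -> Prop) (m : nat) : Prop :=
  [/\ H m, 0 < m & forall n, H n -> 0 < n -> m <= n].

Definition inZ (H : nat -> Prop) (a : int) : Prop :=
  exists2 n : nat, a = n%:Z & H n.

(* [F] may be [-1], namely when [H] is all of [nat]. *)
Definition frobenius_number (H : nat -> Prop) (F : int) : Prop :=
  ~ inZ H F /\ forall a : int, ~ inZ H a -> (a <= F)%R.

Definition symmetric_semigroup (H : nat -> Prop) : Prop :=
  exists2 F : int, frobenius_number H F
    & forall a : int, inZ H a <-> ~ inZ H (F - a)%R.

End NumericalSemigroups.

Section Ideals.
Variable R : comNzRingType.
Implicit Types (I J : R -> Prop) (gs : seq R).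

Definition same_ideal I J : Prop := forall f, I f <-> J f.

Definition ideal_span (X : R -> Prop) (f : R) : Prop :=
  exists2 s : seq (R * R), (forall u, u \in s -> X u.2)
    & f = \sum_(u <- s) u.1 * u.2.

Definition ideal_of gs : R -> Prop := ideal_span (fun g => g \in gs).

(* The least number of generators of [I] is [n]; a system of [n] generators is
   then irredundant as well. *)
Definition minimally_generated_by (n : nat) I : Prop :=
  (exists2 gs, size gs = n & same_ideal I (ideal_of gs)) /\
  (forall gs, same_ideal I (ideal_of gs) -> (n <= size gs)%N).

Definition is_ideal I : Prop :=
  [/\ I 0, forall f g, I f -> I g -> I (f + g)
    & forall f g, I g -> I (f * g)].

Definition radical I (f : R) : Prop := exists n : nat, I (f ^+ n).

Definition primary_ideal I : Prop :=
  [/\ is_ideal I, ~ I 1 & forall f g, I (f * g) -> I f \/ radical I g].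

Fixpoint ideal_pow I (n : nat) : R -> Prop :=
  if n is m.+1
  then ideal_span (fun h => exists f g, [/\ I f, ideal_pow I m g & h = f * g])
  else fun=> True.

Definition integral_over_ideal I (f : R) : Prop :=
  exists (n : nat) (c : nat -> R),
    [/\ (0 < n)%N, forall i, (1 <= i <= n)%N -> ideal_pow I i (c i)
      & f ^+ n + \sum_(1 <= i < n.+1) c i * f ^+ (n - i) = 0].

Definition integrally_closed_ideal I : Prop :=
  forall f, integral_over_ideal I f -> I f.

(* Used only with [d < b] and [e <= 1], so the subtractions never truncate. *)
Definition F1_gens (x y z : R) (b d e : nat) : seq R :=
  [:: y ^+ 2 - x ^+ (b - d) * z; x ^+ (2 * b + 2 - e); x ^+ (b + 1) * y;
      x ^+ (b - d + 1) * z; y * z; z ^+ 2].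

Definition F2_gens (x y z : R) (b r : nat) : seq R :=
  [:: y ^+ 2 - x ^+ (2 * b + 1); x ^+ (2 * b + 2); x ^+ (b + 1) * y;
      x ^+ r * z; y * z; z ^+ 2].

End Ideals.

Inductive subalgebra_span (K : nzRingType) (A : lalgType K) (X : A -> Prop) :
    A -> Prop :=
  | subalgebra_gen f of X f : subalgebra_span X f
  | subalgebra_scalar (c : K) : subalgebra_span X c%:A
  | subalgebra_add f g of subalgebra_span X f & subalgebra_span X g :
      subalgebra_span X (f + g)
  | subalgebra_mul f g of subalgebra_span X f & subalgebra_span X g :
      subalgebra_span X (f * g).

Section WeightedDegree.
Variables (n : nat) (a : n.-tuple nat).

Definition wdeg (m : 'X_{1..n}) : nat := (\sum_(i < n) m i * tnth a i)%N.

Fact wdeg0 : wdeg 0%MM = 0%N.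
Proof. by rewrite /wdeg big1 // => i _; rewrite mnm0E mul0n. Qed.

Fact wdegD : {morph wdeg : m1 m2 / (m1 + m2)%MM >-> (m1 + m2)%N}.
Proof.
move=> m1 m2; rewrite /wdeg -big_split /=.
by apply: eq_bigr => i _; rewrite mnmDE mulnDl.
Qed.

HB.instance Definition _ := isMeasure.Build n wdeg wdeg0 wdegD.

End WeightedDegree.

Section SemigroupRings.
Variable k : fieldType.

Definition semigroup_ring (H : nat -> Prop) : {poly k} -> Prop :=
  subalgebra_span (fun f => exists2 h, H h & f = 'X^h).

Variables (n : nat) (a : n.-tuple nat).

Definition phi (f : {mpoly k[n]}) : {poly k} :=
  mmap (@polyC k) (fun i => 'X^(tnth a i)) f.

Definition defining_ideal (f : {mpoly k[n]}) : Prop := phi f = 0.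

(* [I_h], the inverse image under [phi] of the intersection of [t^h k[t]]
   and [k[H]]. *)
Definition value_ideal (H : nat -> Prop) (h : nat) (f : {mpoly k[n]}) : Prop :=
  'X^h %| phi f /\ semigroup_ring H (phi f).

Definition homogeneous_relation (l : nat) : Prop :=
  exists f : {mpoly k[n]},
    [/\ f != 0, f \is @ishomog1 n k l (wdeg a) & defining_ideal f].

Definition least_relation_degree (l : nat) : Prop :=
  homogeneous_relation l /\ forall d, homogeneous_relation d -> (l <= d)%N.

End SemigroupRings.

(* Main.v *)
Require Import Defs.
From HB Require Import structures.
From mathcomp Require Import all_boot all_order all_fingroup all_algebra.
From mathcomp.multinomials Require Import mpoly.
From mathcomp Require Import zify ring.

(** [I_(l+1)] consists of the polynomials whose image under [phi] has no term of
    degree at most [l].  Below degree [l] distinct monomials have distinct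
    degrees, and in all cases exactly two monomials have degree [l], so
    [I_(l+1)] is generated by their difference and by the monomials of degree
    greater than [l]; everything becomes a computation with the residues of the
    generators modulo the multiplicity.  With generators [4, p, q], [q = 2 mod 4]
    gives the symmetric semigroups: [l = 2p] (form F1) if [p < q], while if
    [q < p] then [l = 2q] and the outcome is F2 or, when [y] itself has degree
    beyond [l], the contraction of an ideal of the valuation of [k[t]].
    Otherwise [p] and [q] are odd with sum divisible by 4, the relation of least
    degree is [y z - x^u] or [y^3 - x^v z], and the seven generators are
    independent modulo the maximal ideal times [I_(l+1)], by seven functionals
    which extract coefficients. *)

Set Implicit Arguments.
Unset Strict Implicit.
Unset Printing Implicit Defensive.

Import GRing.Theory.
Local Open Scope ring_scope.

(** * Ideals and numbers of generators *)

Section IdealTheory.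
Variable R : comNzRingType.
Implicit Types (I : R -> Prop) (X : R -> Prop) (gs : seq R).

Lemma ideal_spanP X : is_ideal (ideal_span X).
Proof.
split.
- by exists [::]; rewrite ?big_nil.
- move=> f g [s sX ->] [t tX ->]; exists (s ++ t); last by rewrite big_cat.
  by move=> u; rewrite mem_cat => /orP [us|ut]; [apply: sX|apply: tX].
- move=> f g [s sX ->]; exists [seq (f * u.1, u.2) | u <- s].
    by move=> _ /mapP [u us ->]; exact: (sX u us).
  by rewrite big_map big_distrr; apply: eq_bigr => u _; rewrite /= mulrA.
Qed.

Lemma mem_ideal_span X g : X g -> ideal_span X g.
Proof.
move=> Xg; exists [:: (1, g)]; first by move=> u; rewrite inE => /eqP ->.
by rewrite big_seq1 mul1r.
Qed.

Lemma ideal_span_min X I :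
  is_ideal I -> (forall g, X g -> I g) -> forall f, ideal_span X f -> I f.
Proof.
move=> [I0 ID IM] XI f [s sX ->]; rewrite big_seq.
by apply: (big_ind I) => // u us; apply: IM; apply: XI; apply: sX.
Qed.

Lemma ideal_sum I (T : Type) (r : seq T) (P : pred T) (F : T -> R) :
  is_ideal I -> (forall i, P i -> I (F i)) -> I (\sum_(i <- r | P i) F i).
Proof. by case=> I0 ID _ IF; apply: (big_ind I). Qed.

Lemma ideal_opp I f : is_ideal I -> I f -> I (- f).
Proof. by case=> _ _ IM If; rewrite -mulN1r; apply: IM. Qed.

Lemma ideal_dvd I (x y z : R) i0 j0 k0 i j k : is_ideal I ->
  I (x ^+ i0 * y ^+ j0 * z ^+ k0) -> (i0 <= i)%N -> (j0 <= j)%N ->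
  (k0 <= k)%N -> I (x ^+ i * y ^+ j * z ^+ k).
Proof.
case=> _ _ IM Im lei lej lek.
have -> : x ^+ i * y ^+ j * z ^+ k = x ^+ (i - i0) * y ^+ (j - j0) *
  z ^+ (k - k0) * (x ^+ i0 * y ^+ j0 * z ^+ k0).
  rewrite -{1}(subnK lei) -{1}(subnK lej) -{1}(subnK lek) !exprD; ring.
exact: IM.
Qed.

(** Modulo the binomial, one monomial factor may be traded for the other: the two products differ by
    a multiple of the binomial. *)
Lemma ideal_swap I (x y z : R) i0 j0 k0 i1 j1 k1 i j k : is_ideal I ->
  I (x ^+ i0 * y ^+ j0 * z ^+ k0 - x ^+ i1 * y ^+ j1 * z ^+ k1) ->
  (i0 <= i)%N -> (j0 <= j)%N -> (k0 <= k)%N ->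
  I (x ^+ (i - i0 + i1) * y ^+ (j - j0 + j1) * z ^+ (k - k0 + k1)) ->
  I (x ^+ i * y ^+ j * z ^+ k).
Proof.
case=> _ ID IM Im lei lej lek If.
have -> : x ^+ i * y ^+ j * z ^+ k = x ^+ (i - i0) * y ^+ (j - j0) *
  z ^+ (k - k0) * (x ^+ i0 * y ^+ j0 * z ^+ k0 - x ^+ i1 * y ^+ j1 * z ^+ k1) +
  x ^+ (i - i0 + i1) * y ^+ (j - j0 + j1) * z ^+ (k - k0 + k1).
  rewrite -{1}(subnK lei) -{1}(subnK lej) -{1}(subnK lek) !exprD; ring.
by apply: ID => //; apply: IM.
Qed.

End IdealTheory.

(** * Polynomials and their coefficients *)

Section Multinomials.
Variables (n : nat) (k : fieldType).
Implicit Types (f g : {mpoly k[n]}) (m : 'X_{1..n}).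

Lemma mpoly_ind_XD (P : {mpoly k[n]} -> Prop) :
  (forall c m, P (c *: 'X_[m])) -> (forall f g, P f -> P g -> P (f + g)) ->
  forall f, P f.
Proof.
move=> PX PD; apply: mpolyind => [|c m f _ _ Pf]; last exact: PD.
by rewrite -(scale0r 'X_[0%MM]).
Qed.

(** In a product [f * g] with [g] in an ideal [I], this separates the part of [f] that survives
    modulo the maximal ideal times [I]. *)
Lemma mpoly_const_decomp f :
  exists h : 'I_n -> {mpoly k[n]}, f = (f@_0%MM)%:MP + \sum_i 'X_i * h i.
Proof.
elim/mpoly_ind_XD: f => [c m|f g [hf Ef] [hg Eg]]; last first.
  exists (fun i => hf i + hg i); rewrite {1}Ef {1}Eg mcoeffD mpolyCD.
  under [in RHS]eq_bigr do rewrite mulrDr.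
  by rewrite big_split /=; ring.
case: (eqVneq m 0%MM) => [->|m0].
  exists (fun=> 0); rewrite big1 => [|i _]; last by rewrite mulr0.
  by rewrite mcoeffZ mcoeffX eqxx mulr1 addr0 mpolyX0 -mul_mpolyC mulr1.
have [i mi] : exists i, m i != 0%N.
  apply/existsP; rewrite -negb_forall; apply: contra m0 => /forallP m0.
  by apply/eqP/mnmP => i; rewrite mnm0E; apply/eqP.
exists (fun j => if j == i then c *: 'X_[m - U_(i)] else 0).
rewrite (bigD1 i) //= eqxx big1 => [|j /negPf ->]; last exact: mulr0.
rewrite mcoeffZ mcoeffX (negPf m0) mulr0 mpolyC0 add0r addr0.
by rewrite -scalerAr -mpolyXD addmC submK // lep1mP.
Qed.

Lemma mcoeffXM (i : 'I_n) g m :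
  ('X_i * g)@_m = if m i == 0%N then 0 else g@_(m - U_(i)).
Proof.
elim/mpoly_ind_XD: g => [c m'|f g Ef Eg]; last first.
  by rewrite mulrDr !mcoeffD Ef Eg; case: ifP; rewrite ?addr0.
rewrite -scalerAr -mpolyXD !mcoeffZ !mcoeffX; case: (m i =P 0%N) => [mi0|/eqP mi0].
  case: eqP => [E|]; last by rewrite mulr0.
  by move/eqP: mi0; rewrite -E mnmDE mnm1E eqxx.
by rewrite -(eqm_add2l U_(i) m') [(_ + (_ - _))%MM]addmC submK ?lep1mP.
Qed.

End Multinomials.

Section NumberOfGenerators.
Variables (n r : nat) (k : fieldType) (I : {mpoly k[n]} -> Prop).
Variables (T : 'I_r -> seq 'X_{1..n}) (G : 'I_r -> {mpoly k[n]}).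

Let psi (j : 'I_r) (f : {mpoly k[n]}) : k := \sum_(m <- T j) f@_m.

(* The functionals [psi j] vanish on the maximal ideal times [I] and are dual
   to the [G i], so the latter are linearly independent modulo that product. *)
Lemma number_of_generators_ge :
  is_ideal I ->
  (forall j i g, I g -> \sum_(m <- T j) ('X_i * g)@_m = 0) ->
  (forall i, I (G i)) ->
  (forall i j, \sum_(m <- T j) (G i)@_m = (i == j)%:R) ->
  forall gs, same_ideal I (ideal_of gs) -> (r <= size gs)%N.
Proof.
move=> I_ideal TX IG TG gs IE.
have psiD j : {morph psi j : f g / f + g}.
  by move=> f g; rewrite /psi -big_split; apply: eq_bigr => m _; rewrite mcoeffD.
have psi0 j : psi j 0 = 0 by rewrite /psi big1 // => m _; rewrite mcoeff0.
(* Only the constant term of [f] counts, since [psi j] kills each [X_i * (h i * g)]. *)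
have psiM j f g : I g -> psi j (f * g) = f@_0%MM * psi j g.
  move=> Ig; have [h Ef] := mpoly_const_decomp f.
  rewrite {1}Ef mulrDl psiD mulr_suml.
  have -> : psi j (\sum_i 'X_i * h i * g) = 0.
    rewrite (big_morph (psi j) (psiD j) (psi0 j)) big1 // => i _.
    rewrite -mulrA; apply: TX.
    by case: I_ideal => _ _; apply.
  rewrite addr0 /psi big_distrr; apply: eq_bigr => m _ /=.
  by rewrite mul_mpolyC mcoeffZ.
(* Row [t] of [P] lists the functionals on the generator [t] of [gs]. By [psiM] the values on any
   element of [I] form a combination of these rows; the [G i] yield the identity matrix, so [P] has
   rank [r] and at least [r] rows. *)
pose P := \matrix_(t < size gs, j < r) psi j gs`_t.
have span f : ideal_of gs f -> ((\row_j psi j f) <= P)%MS.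
  case=> s sgs ->.
  have -> : \row_j psi j (\sum_(u <- s) u.1 * u.2) =
            \sum_(u <- s | u \in s) u.1@_0%MM *: \row_j psi j u.2.
    apply/rowP=> j; rewrite mxE summxE big_seq.
    rewrite (big_morph (psi j) (psiD j) (psi0 j)); apply: eq_bigr => u us.
    by rewrite !mxE psiM //; apply/IE/mem_ideal_span/sgs.
  apply: summx_sub => u us; apply: scalemx_sub.
  have ult := sgs u us; rewrite -index_mem in ult.
  suff -> : \row_j psi j u.2 = row (Ordinal ult) P by apply: row_sub.
  by apply/rowP=> j; rewrite !mxE nth_index // sgs.
have sub1 : ((1%:M : 'M_r) <= P)%MS.
  apply/row_subP => i.
  suff -> : row i 1%:M = \row_j psi j (G i) by apply/span/IE.
  by apply/rowP=> j; rewrite !mxE /psi TG.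
by rewrite -(mxrank1 k r) (leq_trans (mxrankS sub1)) // rank_leq_row.
Qed.

End NumberOfGenerators.

(** * The homomorphism [phi] and the ideals [I_h] *)

Lemma dvdXnP (k : fieldType) h (p : {poly k}) :
  reflect (forall d, (d < h)%N -> p`_d = 0) ('X^h %| p).
Proof.
apply: (iffP idP) => [/dvdpP [q ->] d dh|p0]; first by rewrite coefMXn dh.
apply/dvdpP; exists (drop_poly h p); rewrite -{1}(poly_take_drop h p).
suff -> : take_poly h p = 0 by rewrite add0r.
by apply/polyP => d; rewrite coef_take_poly coef0; case: ifP => // /p0.
Qed.

Section Phi.
Variables (k : fieldType) (n : nat) (a : n.-tuple nat).
Implicit Types (f g : {mpoly k[n]}) (m : 'X_{1..n}) (H : nat -> Prop).

Lemma phiD : {morph @phi k n a : f g / f + g}.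
Proof. exact: mmapD. Qed.

Lemma phiM : {morph @phi k n a : f g / f * g}.
Proof. by move=> f g; rewrite /phi rmorphM. Qed.

Lemma phi0 : phi a (0 : {mpoly k[n]}) = 0.
Proof. exact: mmap0. Qed.

Lemma phiXn f i : phi a (f ^+ i) = phi a f ^+ i.
Proof. by rewrite /phi rmorphXn. Qed.

Lemma phi1 : phi a (1 : {mpoly k[n]}) = 1.
Proof. by rewrite -(expr0 (0 : {mpoly k[n]})) phiXn expr0. Qed.

Lemma phiX m : phi a 'X_[m] = 'X^(wdeg a m) :> {poly k}.
Proof.
rewrite /phi mmapX /mmap1 /wdeg -prodrXr.
by apply: eq_bigr => i _; rewrite -exprM mulnC.
Qed.

Lemma wdegU i : wdeg a U_(i) = tnth a i.
Proof.
rewrite /wdeg (bigD1 i) //= big1 => [|j ji]; rewrite mnm1E.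
  by rewrite eqxx mul1n addn0.
by rewrite eq_sym (negPf ji).
Qed.

Lemma phiU i : phi a 'X_i = 'X^(tnth a i) :> {poly k}.
Proof. by rewrite phiX wdegU. Qed.

Lemma phiC c : phi a (c%:MP : {mpoly k[n]}) = c%:P.
Proof. by rewrite /phi mmapC. Qed.

Lemma phiZ c f : phi a (c *: f) = c *: phi a f.
Proof. by rewrite -mul_mpolyC phiM phiC mul_polyC. Qed.

(** The list [r] is the whole fibre of [wdeg a] over [d]; every use below has one or two monomials
    there. *)
Lemma phi_coef f d (r : seq 'X_{1..n}) : uniq r ->
  (forall m, (m \in r) = (wdeg a m == d)) ->
  (phi a f)`_d = \sum_(m <- r) f@_m.
Proof.
move=> r_uniq rE; elim/mpoly_ind_XD: f => [c m|f g Ef Eg]; last first.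
  by rewrite phiD coefD Ef Eg -big_split; apply: eq_bigr => m _; rewrite mcoeffD.
rewrite phiZ phiX coefZ coefXn eq_sym -rE.
under eq_bigr do rewrite mcoeffZ mcoeffX.
rewrite -big_distrr; congr (_ * _) => /=.
case: (boolP (m \in r)) => mr.
  rewrite (bigD1_seq m) //= eqxx big1 ?addr0 // => m'.
  by rewrite eq_sym => /negPf ->.
rewrite big_seq big1 // => m' m'r; case: eqP => // E.
by rewrite E m'r in mr.
Qed.

Lemma semigroup_ring_phi H f : numerical_semigroup H ->
  (forall i, H (tnth a i)) -> semigroup_ring H (phi a f).
Proof.
case=> H0 HD _ Ha; elim/mpoly_ind_XD: f => [c m|f g Ef Eg]; last first.
  by rewrite phiD; apply: subalgebra_add.
rewrite phiZ phiX -mulr_algl; apply: subalgebra_mul.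
  exact: subalgebra_scalar.
apply: subalgebra_gen; exists (wdeg a m) => //; rewrite /wdeg.
apply: (big_ind H) => // i _; elim: (m i) => [|j IH]; first by rewrite mul0n.
by rewrite mulSn; apply: HD.
Qed.

(** The second condition is automatic, since [phi] takes its values in [k[H]]. *)
Lemma value_idealE H h f : numerical_semigroup H ->
  (forall i, H (tnth a i)) -> value_ideal a H h f <-> 'X^h %| phi a f.
Proof.
by move=> HH Ha; split=> [[]|] // hf; split=> //; apply: semigroup_ring_phi.
Qed.

Lemma dvd_phi_ideal h : is_ideal (fun f => is_true ('X^h %| phi a f)).
Proof.
split; first by rewrite phi0 dvdp0.
- by move=> f g hf hg; rewrite phiD dvdp_addr.
- by move=> f g hg; rewrite phiM dvdp_mull.
Qed.

Definition degrees_distinct_below l :=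
  forall m m', wdeg a m = wdeg a m' -> (wdeg a m < l)%N -> m = m'.

(** The difference of the two monomials is a relation of degree [l]. In a smaller degree a
    homogeneous element has a single term, whose coefficient [phi] carries over unchanged. *)
Lemma least_relation_degreeI l m1 m2 : m1 != m2 -> wdeg a m1 = l ->
  wdeg a m2 = l -> degrees_distinct_below l -> least_relation_degree k a l.
Proof.
move=> m12 d1 d2 dist; split.
  exists ('X_[m1] - 'X_[m2]); split.
  - apply/eqP=> /mpolyP /(_ m1); rewrite mcoeffB !mcoeffX eqxx eq_sym (negPf m12).
    by rewrite subr0 mcoeff0; apply/eqP/oner_neq0.
  - by rewrite rpredB // dhomogX; apply/eqP.
  - by rewrite /defining_ideal /phi mmapB -!/(phi _ _) !phiX d1 d2 subrr.
move=> d [f [f0 f_hom f_rel]]; rewrite leqNgt; apply/negP => dl.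
case E: (msupp f) => [|m r].
  by move/eqP: E; rewrite msupp_eq0 (negPf f0).
have mf : m \in msupp f by rewrite E mem_head.
have dm : wdeg a m = d by apply/eqP; exact: (allP f_hom m mf).
have := phi_coef f (d := d) (r := [:: m]) isT.
rewrite big_seq1 f_rel coef0 => /(_ _)/esym fm0; move: mf; rewrite mcoeff_msupp fm0 ?eqxx //.
move=> m'; rewrite inE; apply/eqP/eqP => [-> //|d'].
by apply: dist; rewrite d' ?dm.
Qed.

Lemma least_relation_degree_inj l l' :
  least_relation_degree k a l -> least_relation_degree k a l' -> l = l'.
Proof.
by move=> [hl ml] [hl' ml']; apply/eqP; rewrite eqn_leq ml // ml'.
Qed.

(** Each degree [d <= l] attained by a monomial gets a representative [rho d]. Modulo [J], every [f]
    is congruent to the sum of the [rho d] weighted by the coefficients of [phi a f], and these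
    vanish when [X^(l+1)] divides [phi a f]. *)
Lemma dvd_phi_sub (J : {mpoly k[n]} -> Prop) l : is_ideal J ->
  (forall i, 0 < tnth a i)%N -> degrees_distinct_below l ->
  (forall m, (l < wdeg a m)%N -> J 'X_[m]) ->
  (forall m m', wdeg a m = l -> wdeg a m' = l -> J ('X_[m] - 'X_[m'])) ->
  forall f, 'X^(l.+1) %| phi a f -> J f.
Proof.
move=> J_ideal a0 dist J_hi J_l f /dvdXnP f0; case: (J_ideal) => J0 JD JM.
(* As the weights are positive, the monomials of weighted degree at most [l] have total degree at
   most [l] and lie in a finite type, where [pick] can search. *)
have mdeg_le m : (mdeg m <= wdeg a m)%N.
  rewrite mdegE /wdeg; apply: leq_sum => i _.
  by rewrite -[X in (X <= _)%N]muln1 leq_mul2l a0 orbT.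
pose rho d : {mpoly k[n]} :=
  if [pick m : 'X_{1..n < l.+1} | wdeg a m == d] is Some m
  then 'X_[bmnm m] else 0.
have J_rho m : (wdeg a m <= l)%N -> J ('X_[m] - rho (wdeg a m)).
  move=> ml; rewrite /rho; case: pickP => [m' /eqP Em'|].
    case: (ltngtP (wdeg a m) l) ml => // Em _; last first.
      by apply: J_l; rewrite // Em'.
    by rewrite (dist m m') // subrr.
  have bm : (mdeg m < l.+1)%N by apply: leq_ltn_trans (mdeg_le m) _.
  by move/(_ (BMultinom bm)); rewrite /= eqxx.
suff: J (f - \sum_(d < l.+1) (phi a f)`_d *: rho d).
  by rewrite big1 ?subr0 // => d _; rewrite f0 ?scale0r.
(* The congruence holds for arbitrary [f], so the divisibility is discarded and single terms
   suffice. *)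
elim/mpoly_ind_XD: {f0} f => [c m|f g Jf Jg]; last first.
  rewrite phiD; under eq_bigr do rewrite coefD scalerDl.
  by rewrite big_split opprD addrACA; apply: JD.
rewrite phiZ phiX.
under eq_bigr do rewrite coefZ coefXn -scalerA.
rewrite -scaler_sumr -scalerBr -mul_mpolyC; apply: (JM).
case: (leqP (wdeg a m) l) => ml.
  rewrite (bigD1 (Ordinal (ml : wdeg a m < l.+1)%N)) //= eqxx scale1r.
  rewrite big1 ?addr0; first exact: J_rho.
  move=> d; rewrite -val_eqE /= => /negPf ->; exact: scale0r.
rewrite big1 ?subr0; first exact: J_hi.
move=> d _; rewrite ltn_eqF ?scale0r //.
by apply: leq_ltn_trans ml; rewrite -ltnS.
Qed.

End Phi.

(** * Monomials in three variables *)

(** Exponents of [x], [y], [z] as plain numbers, so that conditions on degrees become arithmetic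
    goals. *)
Definition triple := (nat * nat * nat)%type.

Section Triples.
Local Open Scope nat_scope.
Implicit Types t : triple.

Definition tadd t t' : triple := (t.1.1 + t'.1.1, t.1.2 + t'.1.2, t.2 + t'.2).
Definition tsub t t' : triple := (t.1.1 - t'.1.1, t.1.2 - t'.1.2, t.2 - t'.2).
Definition tle t t' := [&& t.1.1 <= t'.1.1, t.1.2 <= t'.1.2 & t.2 <= t'.2].
Definition tsucc t : triple := (t.1.1.+1, t.1.2, t.2).

Definition covered (ts : seq triple) t := has (fun t' => tle t' t) ts.

Variables al be ga : nat.

Definition tdeg t := al * t.1.1 + be * t.1.2 + ga * t.2.

(** By the last two conditions, the homogeneous relations of degree [l] are the scalar multiples of
    the difference of [t1] and [t2], and there are no nonzero ones below. *)
Definition first_relation l t1 t2 : Prop :=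
  [/\ t1 != t2, tdeg t1 = l, tdeg t2 = l,
      forall t, tdeg t = l -> t = t1 \/ t = t2
    & forall t t', tdeg t = tdeg t' -> tdeg t < l -> t = t'].

(* One replacement of [t1] by [t2] suffices for all the ideals at hand. *)
Definition generating_beyond l t1 t2 ts : Prop :=
  (forall t, t \in ts -> l < tdeg t) /\
  (forall t, l < tdeg t ->
     covered ts t || tle t1 t && covered ts (tadd (tsub t t1) t2)).

(* A functional extracting the coefficient of a tight monomial kills [x I],
   [y I] and [z I], as elements of [I_(l+1)] have no terms of degree below [l]. *)
Definition tight l t : Prop :=
  [/\ 0 < t.1.1 -> tdeg t < l + al, 0 < t.1.2 -> tdeg t < l + be
    & 0 < t.2 -> tdeg t < l + ga].

End Triples.

Definition tmon (R : comNzRingType) (x y z : R) (t : triple) :=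
  x ^+ t.1.1 * y ^+ t.1.2 * z ^+ t.2.

Definition binomial_gens (R : comNzRingType) (x y z : R) t1 t2 ts :=
  tmon x y z t1 - tmon x y z t2 :: map (tmon x y z) ts.

Lemma covered_mem (R : comNzRingType) (x y z : R) (I : R -> Prop) ts t :
  is_ideal I -> (forall t', t' \in ts -> I (tmon x y z t')) ->
  covered ts t -> I (tmon x y z t).
Proof.
move=> I_ideal Its /hasP [t' /Its It' /and3P [le1 le2 le3]].
exact: ideal_dvd It' _ _ _.
Qed.

(** * Three variables renamed by a permutation *)

Section ThreeVariables.
Variables (k : fieldType) (a : 3.-tuple nat) (s : 'S_3).
Local Notation al := (tnth a (s 0)).
Local Notation be := (tnth a (s 1)).
Local Notation ga := (tnth a (s 2%:R)).
Local Notation x := ('X_(s 0) : {mpoly k[3]}).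
Local Notation y := ('X_(s 1) : {mpoly k[3]}).
Local Notation z := ('X_(s 2%:R) : {mpoly k[3]}).
Local Notation tdg := (tdeg al be ga).

Definition mon (t : triple) : 'X_{1..3} :=
  (U_(s 0%R) *+ t.1.1 + U_(s 1%R) *+ t.1.2 + U_(s 2%:R%R) *+ t.2)%MM.

Lemma ord3_cases (i : 'I_3) : [\/ i = s 0, i = s 1 | i = s 2%:R].
Proof.
rewrite -(permKV s i); case: ((s^-1)%g i) => [[|[|[|//]]] Hi].
- by constructor 1; congr (s _); apply: val_inj.
- by constructor 2; congr (s _); apply: val_inj.
- by constructor 3; congr (s _); apply: val_inj.
Qed.

Lemma mon_val t : [/\ mon t (s 0) = t.1.1, mon t (s 1) = t.1.2
  & mon t (s 2%:R) = t.2].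
Proof.
rewrite /mon; split; rewrite !mnmDE !mulmnE !mnm1E !(inj_eq perm_inj) /=;
  rewrite ?mul1n ?mul0n ?addn0 //.
Qed.

Lemma mon_inj : injective mon.
Proof.
move=> [[i j] c] [[i' j'] c'] E.
by have := mon_val (i, j, c); rewrite E; case: (mon_val (i', j', c')) => -> -> ->
  /= [-> -> ->].
Qed.

Lemma mon_surj m : exists t, m = mon t.
Proof.
exists (m (s 0), m (s 1), m (s 2%:R)); apply/mnmP => i.
case: (mon_val (m (s 0), m (s 1), m (s 2%:R))) => /= E0 E1 E2.
by case: (ord3_cases i) => ->; rewrite ?E0 ?E1 ?E2.
Qed.

Lemma mpolyX_mon t : 'X_[mon t] = tmon x y z t.
Proof. by rewrite /mon /tmon !mpolyXD !mpolyXn. Qed.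

Lemma wdeg_mon t : wdeg a (mon t) = tdg t.
Proof.
have wdegMn m c : wdeg a (m *+ c)%MM = (wdeg a m * c)%N.
  elim: c => [|c IH]; first by rewrite mulm0n wdeg0 muln0.
  by rewrite mulmS wdegD IH mulnS.
by rewrite /mon !wdegD !wdegMn !wdegU.
Qed.

Lemma first_relation_degrees l t1 t2 : first_relation al be ga l t1 t2 ->
  degrees_distinct_below a l.
Proof.
case=> _ _ _ _ dist m m'; have [t ->] := mon_surj m.
by have [t' ->] := mon_surj m'; rewrite !wdeg_mon => E lt; rewrite (dist t t').
Qed.

Lemma first_relation_least l t1 t2 : first_relation al be ga l t1 t2 ->
  least_relation_degree k a l.
Proof.
move=> rel; case: (rel) => t12 d1 d2 _ _.
apply: (@least_relation_degreeI _ _ _ _ (mon t1) (mon t2)).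
- by rewrite (inj_eq mon_inj).
- by rewrite wdeg_mon.
- by rewrite wdeg_mon.
- exact: first_relation_degrees rel.
Qed.

Section ValueIdeal.
Variables (H : nat -> Prop).
Hypothesis H_semigroup : numerical_semigroup H.
Hypothesis aH : forall i, H (tnth a i).
Hypothesis a_gt0 : forall i, (0 < tnth a i)%N.
Variables (l : nat) (t1 t2 : triple).
Hypothesis rel : first_relation al be ga l t1 t2.

Lemma value_ideal_mon t : (l < tdg t)%N -> value_ideal a H l.+1 (tmon x y z t).
Proof.
move=> lt; apply/value_idealE => //.
by rewrite -mpolyX_mon phiX wdeg_mon dvdp_exp2l.
Qed.

(** The inclusion from left to right is [dvd_phi_sub]: a monomial beyond [l] is divisible by one in
    [ts], at the latest after one trade of [t1] for [t2], and in degree [l] two distinct monomials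
    differ by the binomial up to sign. *)
Lemma value_ideal_binomial_gens ts : generating_beyond al be ga l t1 t2 ts ->
  same_ideal (value_ideal a H l.+1) (ideal_of (binomial_gens x y z t1 t2 ts)).
Proof.
case: (rel) => _ d1 d2 only _ [ts_hi ts_gen] f.
set gs := binomial_gens _ _ _ _ _ _.
have gs_ideal : is_ideal (ideal_of gs) by apply: ideal_spanP.
have Jbin : ideal_of gs (tmon x y z t1 - tmon x y z t2).
  by apply: mem_ideal_span; rewrite mem_head.
have Jts t : t \in ts -> ideal_of gs (tmon x y z t).
  by move=> tin; apply: mem_ideal_span; rewrite inE map_f ?orbT.
split.
  move/(value_idealE _ _ H_semigroup aH).
  apply: dvd_phi_sub => //; first exact: first_relation_degrees rel.
    move=> m; have [t ->] := mon_surj m; rewrite wdeg_mon mpolyX_mon.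
    move=> /ts_gen/orP [|/andP [/and3P [le1 le2 le3] cov]].
      exact: covered_mem.
    by apply: (ideal_swap gs_ideal Jbin) => //; exact: (covered_mem gs_ideal Jts cov).
  move=> m m'; have [t ->] := mon_surj m; have [t' ->] := mon_surj m'.
  rewrite !wdeg_mon !mpolyX_mon => /only Et /only Et'.
  have J0 : ideal_of gs 0 by case: gs_ideal.
  case: Et Et' => -> [] ->; rewrite ?subrr //.
  by rewrite -opprB; apply: ideal_opp.
move=> Jf; apply/value_idealE => //.
move: f Jf; apply: ideal_span_min; first exact: dvd_phi_ideal.
move=> g; rewrite inE => /orP [/eqP ->|/mapP [t tts ->]].
  rewrite -!mpolyX_mon /phi mmapB -!/(phi _ _) !phiX !wdeg_mon d1 d2 subrr.
  exact: dvdp0.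
by rewrite -mpolyX_mon phiX wdeg_mon dvdp_exp2l // ts_hi.
Qed.

Lemma value_ideal_is_ideal : is_ideal (@value_ideal k 3 a H l.+1).
Proof.
have [d0 dD dM] := dvd_phi_ideal k a l.+1.
split=> [|f g|f g]; rewrite !value_idealE //; [exact: dD|exact: dM].
Qed.

(** If [X_i] divides [m], the coefficient is that of [g] at the quotient. The latter has degree
    below [l] and is alone in its degree, so this is a coefficient of [phi a g], which vanishes. *)
Lemma value_ideal_coef_low (g : {mpoly k[3]}) i (m : 'X_{1..3}) : value_ideal a H l.+1 g ->
  ((0 < m i)%N -> (wdeg a m < l + tnth a i)%N) -> ('X_i * g)@_m = 0.
Proof.
move=> /(value_idealE _ _ H_semigroup aH)/dvdXnP g0 lt; rewrite mcoeffXM.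
case: eqP => // /eqP; rewrite -lt0n => mi; have {lt} := lt mi.
rewrite -{1}(@submK _ U_(i) m) ?lep1mP -?lt0n // wdegD wdegU.
rewrite ltn_add2r; set m' := (m - _)%MM => lt.
have := @phi_coef _ _ a g (wdeg a m') [:: m'] isT.
rewrite g0 ?big_seq1; last exact: leqW.
move=> <- //.
move=> m''; rewrite inE; apply/eqP/eqP => [-> //|E].
by apply: (first_relation_degrees rel) => //; rewrite E.
Qed.

(** The sum is the coefficient of [t^l] in [phi a g], since [t1] and [t2] are all the monomials of
    degree [l]. *)
Lemma value_ideal_coef_rel (g : {mpoly k[3]}) : value_ideal a H l.+1 g ->
  g@_(mon t1) + g@_(mon t2) = 0.
Proof.
move=> /(value_idealE _ _ H_semigroup aH)/dvdXnP g0.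
case: (rel) => t12 d1 d2 only _.
have := @phi_coef _ _ a g l [:: mon t1; mon t2].
rewrite g0 // big_cons big_seq1 => <- //.
  by rewrite /= inE (inj_eq mon_inj) t12.
move=> m; have [t ->] := mon_surj m; rewrite !inE !(inj_eq mon_inj) wdeg_mon.
apply/orP/eqP => [[/eqP -> //|/eqP -> //]|/only [->|->]]; rewrite eqxx; auto.
Qed.

Lemma tight_coef (g : {mpoly k[3]}) i t : tight al be ga l t ->
  value_ideal a H l.+1 g -> ('X_i * g)@_(mon t) = 0.
Proof.
move=> [tx ty tz] Ig; apply: value_ideal_coef_low => //; rewrite wdeg_mon.
have [E0 E1 E2] := mon_val t.
by case: (ord3_cases i) => ->; rewrite ?E0 ?E1 ?E2.
Qed.

Lemma mon_tsucc t : mon (tsucc t) = (mon t + U_(s 0%R))%MM.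
Proof. by rewrite /mon /= mulmSr -!addmA; congr (_ + _)%MM; rewrite addmC -addmA. Qed.

(** The functional dual to [tsucc t2] has to add the coefficients at [tsucc t1] and [tsucc t2]: a
    single one of them does not vanish on [x] times the binomial. The other functionals are
    coefficients at tight monomials, with [t1] accounting for the binomial. *)
Lemma value_ideal_gens_ge (ts : seq triple) :
  (forall t, t \in ts -> (l < tdg t)%N) ->
  uniq (tsucc t2 :: ts) -> tsucc t1 \notin ts ->
  (forall t, t \in t1 :: ts -> tight al be ga l t) ->
  (forall t, t \in [:: tsucc t1; tsucc t2] ->
     (0 < t.1.2 -> tdg t < l + be)%N /\ (0 < t.2 -> tdg t < l + ga)%N) ->
  forall gs, same_ideal (@value_ideal k 3 a H l.+1) (ideal_of gs) ->
    ((size ts).+2 <= size gs)%N.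
Proof.
case: (rel) => t12 d1 d2 only _ ts_hi /= /andP [t2ts ts_uniq] t1ts ts_tight yz.
have dsucc t : tdg (tsucc t) = (tdg t + al)%N by rewrite /tdeg /=; lia.
have al0 : (0 < al)%N by [].
pose T (j : 'I_(size ts).+2) := nth [::] ([:: mon t1] ::
  [:: mon (tsucc t2); mon (tsucc t1)] :: [seq [:: mon t] | t <- ts]) j.
pose G (j : 'I_(size ts).+2) : {mpoly k[3]} := nth 0 ('X_[mon t1] - 'X_[mon t2] ::
  'X_[mon (tsucc t2)] :: [seq 'X_[mon t] | t <- ts]) j.
pose t0 : triple := (0, 0, 0)%N.
apply: (@number_of_generators_ge _ _ _ _ T G).
- exact: value_ideal_is_ideal.
- case=> [[|[|j]] Hj] i g Ig; rewrite /T /=.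
  + by rewrite big_seq1; apply: tight_coef => //; apply: ts_tight; rewrite mem_head.
  + rewrite big_cons big_seq1.
    have [y1 z1] := yz (tsucc t1) (mem_head _ _).
    have [y2 z2] := yz (tsucc t2) (mem_last (tsucc t1) [:: tsucc t2]).
    have [-> | E | E] := ord3_cases i.
    (* Multiplication by [x] turns the two coefficients into those of [g] at [t1] and [t2], whose
       sum is zero; for [y] and [z] each coefficient vanishes on its own. *)
    * rewrite !mcoeffXM !mon_tsucc !mnmDE mnm1E eqxx !addn1 /= !addmK addrC.
      exact: value_ideal_coef_rel.
    * rewrite !value_ideal_coef_low ?addr0 // E wdeg_mon.
        by case: (mon_val (tsucc t1)) => _ -> _.
      by case: (mon_val (tsucc t2)) => _ -> _.
    * rewrite !value_ideal_coef_low ?addr0 // E wdeg_mon.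
        by case: (mon_val (tsucc t1)) => _ _ ->.
      by case: (mon_val (tsucc t2)) => _ _ ->.
  + rewrite (nth_map t0) // big_seq1; apply: tight_coef => //; apply: ts_tight.
    by rewrite inE mem_nth ?orbT.
- have I_mon t : (l < tdg t)%N -> value_ideal a H l.+1 ('X_[mon t] : {mpoly k[3]}).
    by move=> lt; rewrite mpolyX_mon; apply: value_ideal_mon.
  case=> [[|[|j]] Hj]; rewrite /G /=.
  + apply/value_idealE => //.
    by rewrite /phi mmapB -!/(phi _ _) !phiX !wdeg_mon d1 d2 subrr dvdp0.
  + by apply: I_mon; rewrite dsucc d2; lia.
  + by rewrite (nth_map t0) //; apply/I_mon/ts_hi/mem_nth.
(* For the duality, the terms of the binomial have degree [l] and all other monomials lie beyond;
   what remains is the distinctness of the latter. *)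
have neq t t' : tdg t != tdg t' -> (t == t') = false.
  by apply: contraNF => /eqP ->.
have hi t : (l < tdg t)%N -> ((t == t1) = false) * ((t1 == t) = false) *
    ((t == t2) = false) * ((t2 == t) = false).
  by move=> lt; rewrite !neq ?d1 ?d2 //; lia.
have hi_succ t : tdg t = l -> (l < tdg (tsucc t))%N by rewrite dsucc; lia.
have ts_hi' j : (j < size ts)%N -> (l < tdg (nth t0 ts j))%N.
  by move=> jt; apply/ts_hi/mem_nth.
have tsucc12 : (tsucc t2 == tsucc t1) = false.
  apply: contraNF t12 => /eqP.
  by case: (t1) (t2) => [[? ?] ?] [[? ?] ?] [-> -> ->].
have nts t j : t \notin ts -> (j < size ts)%N ->
    ((t == nth t0 ts j) = false) * ((nth t0 ts j == t) = false).
  move=> nt jt.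
  by split; [|rewrite eq_sym]; apply: contraNF nt => /eqP ->; apply: mem_nth.
case=> [[|[|i]] Hi] [[|[|j]] Hj]; rewrite /T /G -val_eqE /= ?(nth_map t0) //
  ?big_cons ?big_nil ?addr0 ?mcoeffB !mcoeffX ?(inj_eq mon_inj).
- by rewrite eqxx eq_sym (negPf t12) subr0.
- by rewrite !hi ?hi_succ // !subr0 addr0.
- by rewrite !hi ?ts_hi' // subr0.
- by rewrite !hi ?hi_succ.
- by rewrite eqxx tsucc12 addr0.
- by rewrite (nts (tsucc t2)).
- by rewrite !hi ?ts_hi'.
- by rewrite !nts // addr0.
- by rewrite nth_uniq.
Qed.

End ValueIdeal.
End ThreeVariables.

(** * Degree computations *)

Section Numerics.
Local Open Scope nat_scope.

Ltac triple_lia :=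
  first [ exfalso; lia | left; congr (_, _, _); lia
        | right; congr (_, _, _); lia | congr (_, _, _); lia ].

Definition F1_triples b d e : seq triple :=
  [:: (2 * b + 2 - e, 0, 0); (b + 1, 1, 0); (b - d + 1, 0, 1); (0, 1, 1);
      (0, 0, 2)].

Definition F2_triples b r : seq triple :=
  [:: (2 * b + 2, 0, 0); (b + 1, 1, 0); (r, 0, 1); (0, 1, 1); (0, 0, 2)].

(** Below degree [2 * be] at most one factor [y] or [z] occurs, and [0], [be], [ga] are distinct
    modulo [al]. In degree [2 * be], which is congruent to [ga], the only rival of [y^2] is
    [x^m z]. *)
Lemma F1_relation al be ga m : al = 3 \/ al = 4 ->
  (forall u, be <> al * u) -> (forall u, ga <> al * u) ->
  (forall u, ga <> be + al * u) -> (forall u, 2 * be <> al * u) ->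
  be < ga -> ga + al * m = 2 * be ->
  first_relation al be ga (2 * be) (0, 2, 0) (m, 0, 1).
Proof.
move=> al34 nbe nga ngabe nbe2 ltbg eqm; rewrite /first_relation /tdeg /=.
split; rewrite ?xpair_eqE ?andbF //; try lia.
- case=> [[i j] c] /= E; have := nbe i; have := nbe2 i => nbe2i nbei.
  case: c E => [|[|c]]; case: j => [|[|[|j]]]; rewrite ?mulnS => E;
    case: al34 => ?; subst al; triple_lia.
have small i j c : al * i + be * j + ga * c < 2 * be -> j + c <= 1.
  by case: c j => [|[|c]] [|[|j]]; rewrite ?mulnS; lia.
case=> [[i j] c] [[i' j'] c'] /= E lt.
have := small _ _ _ lt; rewrite E in lt; have := small _ _ _ lt.
have := nbe (i - i'); have := nbe (i' - i) => ? ?.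
have := nga (i - i'); have := nga (i' - i) => ? ?.
have := ngabe (i - i'); have := ngabe (i' - i) => ? ?.
case: c j c' j' E {lt} => [|[|c]] [|[|j]] [|[|c']] [|[|j']] // E _ _;
  case: al34 => ?; subst al; triple_lia.
Qed.

(** Here [b] is the integer part of [be / al], and [e] is 1 exactly when
    [2 * be < al * (2 * b + 1)]. The powers of [x] are the least ones taking [1], [y] and [z] beyond
    [2 * be]; multiples of [y^2] are traded for multiples of [x^(b-d) z]. *)
Lemma F1_generating al be ga b d e : al = 3 \/ al = 4 ->
  d < b -> e <= 1 -> be < ga -> ga + al * (b - d) = 2 * be ->
  al * b < be < al * (b + 1) ->
  al * (2 * b + 1 - e) < 2 * be < al * (2 * b + 2 - e) ->
  generating_beyond al be ga (2 * be) (0, 2, 0) (b - d, 0, 1) (F1_triples b d e).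
Proof.
move=> al34 ltdb lee ltbg eqm bb b2; rewrite /generating_beyond /tdeg; split.
  move=> t; rewrite !inE => /or4P [| | |/orP []] /eqP -> /=;
    by case: al34 => ?; subst al; lia.
case=> [[i j] c] /=; rewrite /covered /tle /tadd /tsub /=.
by case: c j => [|[|c]] [|[|[|j]]]; rewrite ?mulnS => lt;
  case: al34 => ?; subst al; lia.
Qed.

(** Monomials with at most one factor [y] or [z] have degrees congruent to 0, to 2, or odd modulo 4,
    according to that factor. *)
Lemma F2_relation be ga b c : be = 4 * b + 2 -> ga = 2 * c + 1 -> be < ga ->
  first_relation 4 be ga (2 * be) (0, 2, 0) (2 * b + 1, 0, 0).
Proof.
move=> Ebe Ega ltbg; rewrite /first_relation /tdeg /=.
split; rewrite ?xpair_eqE ?andbF //; try lia.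
- case=> [[i j] h] /=.
  by case: h j => [|[|h]] [|[|[|j]]]; rewrite ?mulnS => E; triple_lia.
have small i j h : 4 * i + be * j + ga * h < 2 * be -> j + h <= 1.
  by case: h j => [|[|h]] [|[|j]]; rewrite ?mulnS; lia.
case=> [[i j] h] [[i' j'] h'] /= E lt.
have := small _ _ _ lt; rewrite E in lt; have := small _ _ _ lt.
by case: h j h' j' E {lt} => [|[|h]] [|[|j]] [|[|h']] [|[|j']] // E _ _;
  triple_lia.
Qed.

(** The hypothesis on [r] makes it the least exponent for which [x^r z] lies beyond [2 * be]. *)
Lemma F2_generating be ga b r : be = 4 * b + 2 -> be < ga -> 1 <= r ->
  4 * (r - 1) + ga < 2 * be < 4 * r + ga ->
  generating_beyond 4 be ga (2 * be) (0, 2, 0) (2 * b + 1, 0, 0)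
    (F2_triples b r).
Proof.
move=> Ebe ltbg r1 Er; rewrite /generating_beyond /tdeg; split.
  by move=> t; rewrite !inE => /or4P [| | |/orP []] /eqP -> /=; lia.
case=> [[i j] c] /=; rewrite /covered /tle /tadd /tsub /=.
by case: c j => [|[|c]] [|[|[|j]]]; rewrite ?mulnS; lia.
Qed.

(** * Multiplicity four with two odd generators *)

Section OddGenerators.
Variables (be ga h : nat).
Hypothesis be_odd : be = 2 * h + 1.
Hypothesis be_gt4 : 4 < be.
Hypothesis be_lt_ga : be < ga.

Lemma odd_small l i j c u : be + ga = 4 * u -> l <= be + ga -> l <= 3 * be ->
  4 * i + be * j + ga * c < l -> (c = 0 /\ j <= 2) \/ (c = 1 /\ j = 0).
Proof.
by move=> Eu l1 l2; case: c j => [|[|c]] [|[|[|j]]]; rewrite ?mulnS; lia.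
Qed.

(** Only [1], [y], [y^2] and [z] times powers of [x] occur below [l]. As [be] is odd and [ga] is
    congruent to [- be], their residues modulo 4 are distinct. *)
Lemma odd_distinct l u : be + ga = 4 * u -> l <= be + ga -> l <= 3 * be ->
  forall t t', tdeg 4 be ga t = tdeg 4 be ga t' -> tdeg 4 be ga t < l -> t = t'.
Proof.
rewrite /tdeg => Eu l1 l2 [[i j] c] [[i' j'] c'] /= E lt.
have := odd_small Eu l1 l2 lt; rewrite E in lt.
have := odd_small Eu l1 l2 lt.
by case: c j c' j' E {lt} => [|[|c]] [|[|[|j]]] [|[|c']] [|[|[|j']]] E H1 H2;
  triple_lia.
Qed.

Lemma near_relation u : be + ga = 4 * u -> ga < 2 * be ->
  first_relation 4 be ga (be + ga) (0, 1, 1) (u, 0, 0).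
Proof.
move=> Eu lt; split; rewrite ?xpair_eqE ?andbF // /tdeg /=; try lia.
  case=> [[i j] c] /=.
  by case: c j => [|[|c]] [|[|[|j]]]; rewrite ?mulnS => E; triple_lia.
by apply: odd_distinct Eu _ _; lia.
Qed.

Lemma far_relation u v : be + ga = 4 * u -> 2 * be < ga -> ga + 4 * v = 3 * be ->
  first_relation 4 be ga (3 * be) (0, 3, 0) (v, 0, 1).
Proof.
move=> Eu lt Ev; split; rewrite ?xpair_eqE ?andbF // /tdeg /=; try lia.
  case=> [[i j] c] /=.
  by case: c j => [|[|c]] [|[|[|[|j]]]]; rewrite ?mulnS => E; triple_lia.
by apply: odd_distinct Eu _ _; lia.
Qed.

(* The first relation is [y z - x^u] if [ga < 2 be] (near) and [y^3 - x^v z] if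
   [2 be < ga] (far). *)
Definition near_triples u : seq triple :=
  [:: (u.+1, 0, 0); ((ga %/ 4).+1, 1, 0); ((be %/ 4).+1, 0, 1);
      (((ga - be) %/ 4).+1, 2, 0); (0, 3, 0); (0, 0, 2)].

Definition far_triples v : seq triple :=
  [:: (v.+1, 0, 1); ((3 * be %/ 4).+1, 0, 0); ((2 * be %/ 4).+1, 1, 0);
      ((be %/ 4).+1, 2, 0); (0, 1, 1); (0, 0, 2)].

(** The quotients by 4 count the powers of [x] needed to pass [l]: for instance [x^i y] lies beyond
    [be + ga] when [4 * i > ga]. Multiples of [y z] are traded for multiples of [x^u]. *)
Lemma near_generating u : be + ga = 4 * u -> ga < 2 * be ->
  generating_beyond 4 be ga (be + ga) (0, 1, 1) (u, 0, 0) (near_triples u).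
Proof.
move=> Eu lt; rewrite /generating_beyond /tdeg; split.
  move=> t; rewrite !inE.
  by move=> /orP [|/or4P [| | |/orP []]] /eqP -> /=; lia.
case=> [[i j] c] /=; rewrite /covered /tle /tadd /tsub /=.
by case: c j => [|[|c]] [|[|[|j]]]; rewrite ?mulnS; lia.
Qed.

Lemma far_generating v : 2 * be < ga -> ga + 4 * v = 3 * be ->
  generating_beyond 4 be ga (3 * be) (0, 3, 0) (v, 0, 1) (far_triples v).
Proof.
move=> lt Ev; rewrite /generating_beyond /tdeg; split.
  move=> t; rewrite !inE.
  by move=> /orP [|/or4P [| | |/orP []]] /eqP -> /=; lia.
case=> [[i j] c] /=; rewrite /covered /tle /tadd /tsub /=.
by case: c j => [|[|c]] [|[|[|[|j]]]]; rewrite ?mulnS; lia.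
Qed.

(** The head of the list is left out: it is [tsucc t2], whose quotient by [x] has degree exactly
    [l], so it is not tight. *)
Lemma near_tight u t : be + ga = 4 * u -> ga < 2 * be ->
  t \in (0, 1, 1) :: behead (near_triples u) -> tight 4 be ga (be + ga) t.
Proof.
move=> Eu lt; rewrite !inE /tight /tdeg.
by move=> /or4P [| | |/or3P []] /eqP -> /=; split; lia.
Qed.

Lemma far_tight v t : 0 < v -> 2 * be < ga -> ga + 4 * v = 3 * be ->
  t \in (0, 3, 0) :: behead (far_triples v) -> tight 4 be ga (3 * be) t.
Proof.
move=> v0 lt Ev; rewrite !inE /tight /tdeg.
by move=> /or4P [| | |/or3P []] /eqP -> /=; split; lia.
Qed.

Lemma near_uniq u : uniq (near_triples u) /\
  tsucc (0, 1, 1) \notin behead (near_triples u).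
Proof. by split; rewrite /= ?inE !xpair_eqE /= ?andbF. Qed.

Lemma far_uniq v : uniq (far_triples v) /\
  tsucc (0, 3, 0) \notin behead (far_triples v).
Proof. by split; rewrite /= ?inE !xpair_eqE /= ?andbF. Qed.

End OddGenerators.
End Numerics.

(** * Numerical semigroups with three generators *)

Section Generators.
Local Open Scope nat_scope.
Variables (H : nat -> Prop).

(** Otherwise [A] without [g] would still generate, by substituting the combination for [g]. *)
Lemma generator_not_spanned (A : seq nat) g (c : nat -> nat) :
  minimal_generators H A -> g \in A -> g <> \sum_(h <- A | h != g) c h * h.
Proof.
move=> [A_uniq A_gen A_min] gA Eg.
have sub : {subset [seq h <- A | h != g] <= A} by apply: mem_subseq; apply: filter_subseq.
suff: generates [seq h <- A | h != g] H.
  by move/(A_min _ sub)/(_ g gA); rewrite mem_filter eqxx.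
move=> n; rewrite A_gen; split=> [] [c' ->].
  exists (fun h => c' g * c h + c' h).
  rewrite (bigD1_seq g) //= {2}Eg big_filter big_distrr -big_split /=.
  by apply: eq_bigr => h _; rewrite mulnDl mulnA.
exists (fun h => if h == g then 0 else c' h).
rewrite big_filter [RHS](bigD1_seq g) //= eqxx mul0n add0n.
by apply: eq_bigr => h /negPf ->.
Qed.

(** Some generator occurs in an expression of [m]; it is positive and at most [m], hence equal to
    [m]. *)
Lemma multiplicity_generator (A : seq nat) m :
  minimal_generators H A -> multiplicity H m -> m \in A.
Proof.
move=> [A_uniq A_gen _] [Hm m0 m_min].
have [c Em] := (A_gen m).1 Hm.
have /hasP [h hA] : has (fun h => 0 < c h * h) A.
  apply: contraLR m0; rewrite -all_predC => /allP h0; rewrite Em big_seq big1 //.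
  by move=> h /h0 /=; rewrite -eqn0Ngt => /eqP.
rewrite muln_gt0 => /andP [ch0 h0].
suff -> : m = h by [].
apply/eqP; rewrite eqn_leq m_min //=; last first.
  apply/A_gen; exists (fun h' => h' == h : nat).
  by rewrite (bigD1_seq h) //= eqxx mul1n big1 ?addn0 // => h' /negPf ->.
rewrite Em (bigD1_seq h) //=; apply: leq_trans (leq_addr _ _).
exact: leq_pmull.
Qed.

Section Triple.
Variables (a : 3.-tuple nat) (s : 'S_3).
Local Notation al := (tnth a (s 0%R)).
Local Notation be := (tnth a (s 1%R)).
Local Notation ga := (tnth a (s 2%:R%R)).

Lemma tuple_perm_eq : perm_eq a [:: al; be; ga].
Proof.
have E : [:: al; be; ga] = [seq tnth a (s i) | i <- enum 'I_3].
  rewrite enum_ordSl enum_ordSl enum_ordSl enum_ord0 /=.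
  by do !congr (_ :: _); congr (tnth a (s _)); apply: val_inj.
rewrite E (map_comp (tnth a)) -{1}(map_tnth_enum a).
apply: perm_map; apply: uniq_perm; rewrite ?enum_uniq //.
  by rewrite map_inj_uniq ?enum_uniq //; apply: perm_inj.
move=> i; rewrite mem_enum; apply/esym/mapP.
by exists ((s^-1)%g i); rewrite ?mem_enum ?permKV.
Qed.

Lemma submonoid_span_tdeg n : uniq a ->
  submonoid_span a n <-> exists t, n = tdeg al be ga t.
Proof.
rewrite (perm_uniq tuple_perm_eq) /= !inE => /and3P [/norP [n1 n2] n3 _].
have sumE c : \sum_(h <- a) c h * h = al * c al + be * c be + ga * c ga.
  by rewrite (perm_big _ tuple_perm_eq) !big_cons big_nil /= addn0 addnA;
     rewrite ![_ * c _]mulnC.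
split=> [[c]|[[[i j] l] ->]]; rewrite ?sumE.
  by move=> ->; exists (c al, c be, c ga).
exists (fun h => if h == al then i else if h == be then j else l).
rewrite sumE !eqxx /tdeg /=.
by rewrite ![be == al]eq_sym ![ga == _]eq_sym (negPf n1) (negPf n2) (negPf n3).
Qed.

Lemma minimal_triple : minimal_generators H a ->
  [/\ forall n, H n <-> exists t, n = tdeg al be ga t,
      forall u v, be <> al * u + ga * v & forall u v, ga <> al * u + be * v].
Proof.
move=> A_min; have [a_uniq a_gen _] := A_min.
have := a_uniq.
rewrite (perm_uniq tuple_perm_eq) /= !inE => /and3P [/norP [n1 n2] n3 _].
have sumE g c : \sum_(h <- a | h != g) c h * h =
  (al != g) * c al * al + (be != g) * c be * be + (ga != g) * c ga * ga.
  rewrite (perm_big _ tuple_perm_eq) !big_cons big_nil /=.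
  by do 3 case: ifP; rewrite ?mul1n ?mul0n ?add0n ?addn0 ?addnA.
split=> [n|u v E|u v E].
- by rewrite a_gen; apply: submonoid_span_tdeg.
- apply: (generator_not_spanned (c := fun h => if h == al then u else v) A_min
    (mem_tnth (s 1%R) a)).
  rewrite sumE !eqxx n1 [ga == al]eq_sym (negPf n2) [ga == be]eq_sym n3 {1}E; lia.
- apply: (generator_not_spanned (c := fun h => if h == al then u else v) A_min
    (mem_tnth (s 2%:R%R) a)).
  rewrite sumE !eqxx n2 [be == al]eq_sym (negPf n1) n3 {1}E; lia.
Qed.

End Triple.

Lemma swap12 (s : 'S_3) : exists s' : 'S_3,
  [/\ s' 0%R = s 0%R, s' 1%R = s 2%:R%R & s' 2%:R%R = s 1%R].
Proof.
exists (tperm 1%R 2%:R%R * s)%g; rewrite !permM tpermL tpermR tpermD //.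
Qed.

(** The multiplicity is moved to the first place; [P] is a normalization which the other two
    generators satisfy in one of their two orders. *)
Lemma generators_arrangement (a : 3.-tuple nat) m (P : nat -> nat -> Prop) :
  minimal_generators H a -> multiplicity H m ->
  (forall p q, m < p -> m < q ->
     (forall u v, p <> m * u + q * v) -> (forall u v, q <> m * u + p * v) ->
     P p q \/ P q p) ->
  exists s : 'S_3, let p := tnth a (s 1%R) in let q := tnth a (s 2%:R%R) in
    [/\ tnth a (s 0%R) = m, forall n, H n <-> exists t, n = tdeg m p q t,
        m < p /\ m < q,
        (forall u v, p <> m * u + q * v) /\ (forall u v, q <> m * u + p * v)
      & P p q].
Proof.
move=> A_min m_mult PP.
have /tnthP [i Ei] := multiplicity_generator A_min m_mult.
have facts (s : 'S_3) : s 0%R = i ->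
  let p := tnth a (s 1%R) in let q := tnth a (s 2%:R%R) in
  [/\ tnth a (s 0%R) = m, forall n, H n <-> exists t, n = tdeg m p q t,
      m < p /\ m < q
    & (forall u v, p <> m * u + q * v) /\ (forall u v, q <> m * u + p * v)].
  move=> s0 p q; have [HE np nq] := minimal_triple s A_min.
  rewrite s0 -Ei -/p -/q in HE np nq *; split=> //.
  case: m_mult => _ m0 m_min.
  have p0 : 0 < p by rewrite lt0n; apply/eqP => p0; case: (np 0 0); lia.
  have q0 : 0 < q by rewrite lt0n; apply/eqP => q0; case: (nq 0 0); lia.
  split; rewrite ltn_neqAle; apply/andP; split.
  - by apply/eqP => E; apply: (np 1 0); lia.
  - by apply: m_min p0; apply/HE; exists (0, 1, 0); rewrite /tdeg /=; lia.
  - by apply/eqP => E; apply: (nq 1 0); lia.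
  - by apply: m_min q0; apply/HE; exists (0, 0, 1); rewrite /tdeg /=; lia.
pose s : 'S_3 := tperm 0%R i.
have s0 : s 0%R = i by rewrite tpermL.
have [Em HE [mp mq] [np nq]] := facts s s0.
have [Ppq|Pqp] := PP _ _ mp mq np nq; first by exists s; split.
have [s' [s'0 s'1 s'2]] := swap12 s.
exists s'; have := facts s'; rewrite s'0 s'1 s'2 => /(_ s0) [? ? ? ?].
by split.
Qed.

Lemma tuple_semigroup al be ga N : H = submonoid_span [:: al; be; ga] ->
  0 < al -> al < be -> al < ga -> be != ga ->
  (forall u v, be <> al * u + ga * v) -> (forall u v, ga <> al * u + be * v) ->
  (forall n, N <= n -> exists t, n = tdeg al be ga t) ->
  [/\ numerical_semigroup H, minimal_generators H [tuple al; be; ga],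
      multiplicity H al & forall n, H n <-> exists t, n = tdeg al be ga t].
Proof.
move=> EH al0 albe alga bega nbe nga cofin.
have a_uniq : uniq [:: al; be; ga].
  by rewrite /= !inE bega andbT (ltn_eqF albe) (ltn_eqF alga).
have HE n : H n <-> exists t, n = tdeg al be ga t.
  have := @submonoid_span_tdeg [tuple al; be; ga] 1%g n a_uniq.
  by rewrite !perm1 /= EH.
have Hgen : [/\ H al, H be & H ga].
  split; apply/HE; [exists (1, 0, 0) | exists (0, 1, 0) | exists (0, 0, 1)];
    rewrite /tdeg /=; lia.
split=> //.
- split.
  + by apply/HE; exists (0, 0, 0); rewrite /tdeg /= !muln0.
  + move=> m n /HE [t ->] /HE [t' ->]; apply/HE; exists (tadd t t').
    by rewrite /tdeg /tadd /=; lia.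
  + by exists N => n /cofin Hn; apply/HE.
- split=> // [n|B BA B_gen g gA]; first by rewrite EH.
  (* If [g] were missing from [B], it would be a combination of the other two generators, which
     fails by size for [al] and by hypothesis for [be] and [ga]. *)
  have := gA; rewrite -[g \in B]negbK => gA'; apply/negP => gB.
  have two (p q : nat) : (forall h, h \in B -> h = p \/ h = q) -> H g ->
      exists u v, g = p * u + q * v.
    move=> Bpq /B_gen [c ->]; rewrite big_seq.
    apply: (big_ind (fun n => exists u v, n = p * u + q * v)).
    * by exists 0, 0; lia.
    * by move=> _ _ [u [v ->]] [u' [v' ->]]; exists (u + u'), (v + v'); lia.
    * by move=> h /Bpq [] ->; [exists (c p), 0 | exists 0, (c q)]; lia.
  have BA' h : h \in B -> h != g /\ [|| h == al, h == be | h == ga].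
    move=> hB; split; first by apply: contraNneq gB => <-.
    by have := BA h hB; rewrite !inE.
  have [Hal Hbe Hga] := Hgen.
  move: gA'; rewrite !inE => /or3P [] /eqP Eg; rewrite Eg in BA' two *.
  + have [|//|u [v E]] := two be ga; first by move=> h /BA'; lia.
    by case: u v E => [|u] [|v]; rewrite ?mulnS; lia.
  + have [|//|u [v E]] := two al ga; first by move=> h /BA'; lia.
    exact: (nbe u v).
  + have [|//|u [v E]] := two al be; first by move=> h /BA'; lia.
    exact: (nga u v).
- split=> //; first by case: Hgen.
  move=> n /HE [[[i j] c] ->]; rewrite /tdeg /=.
  by case: i j c => [|i] [|j] [|c]; rewrite ?mulnS; lia.
Qed.

(** * Symmetry in multiplicity four *)

Section EvenOdd.
Variables (be ga b c : nat).
Hypothesis be_even : be = 4 * b + 2.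
Hypothesis ga_odd : ga = 2 * c + 1.
Hypothesis be_lt : be < 2 * ga.
Hypothesis HE : forall n, H n <-> exists t, n = tdeg 4 be ga t.

(* The Apery set of [4] is [{0, be, ga, be + ga}]. *)
Lemma even_odd_residue (n : int) : exists q (e1 e2 : bool),
  n = (4 * q + be%:Z * e1%:Z + ga%:Z * e2%:Z)%R.
Proof.
have [h|[h|[h|h]]] : (n = (n %/ 4)%Z * 4 \/
    n = ((n - be%:Z) %/ 4)%Z * 4 + be%:Z \/
    n = ((n - ga%:Z) %/ 4)%Z * 4 + ga%:Z \/
    n = ((n - be%:Z - ga%:Z) %/ 4)%Z * 4 + be%:Z + ga%:Z)%R by lia.
- by exists (n %/ 4)%Z, false, false; lia.
- by exists ((n - be%:Z) %/ 4)%Z, true, false; lia.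
- by exists ((n - ga%:Z) %/ 4)%Z, false, true; lia.
- by exists ((n - be%:Z - ga%:Z) %/ 4)%Z, true, true; lia.
Qed.

Lemma even_odd_inZ (q : int) (e1 e2 : bool) :
  inZ H (4 * q + be%:Z * e1%:Z + ga%:Z * e2%:Z)%R <-> (0 <= q)%R.
Proof.
split=> [[n En /HE [[[i j] l]]]|q0]; last first.
  exists (tdeg 4 be ga (`|q|, e1 : nat, e2 : nat)); last by apply/HE; eexists.
  by rewrite /tdeg /=; case: e1 e2 => [] []; lia.
rewrite /tdeg /= => E.
pose m := c - b; have Em : 2 * ga = be + 4 * m by lia.
(* Pairs of factors [z] are traded by [2 * ga = be + 4 * m], then pairs of factors [y] by
   [2 * be = 4 * (2 * b + 1)]; the remaining parities are determined by the residue modulo 4. *)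
have [l' [d2 El]] : exists l' (d2 : bool), l = 2 * l' + d2.
  by exists l./2, (odd l); rewrite -[LHS]odd_double_half; lia.
have [j' [d1 Ej]] : exists j' (d1 : bool), j + l' = 2 * j' + d1.
  by exists (j + l')./2, (odd (j + l')); rewrite -[LHS]odd_double_half; lia.
have En' : n = 4 * (i + m * l' + (2 * b + 1) * j') + be * d1 + ga * d2 by nia.
move: (i + _ + _) En' => w En'.
by case: e1 d1 e2 d2 En En' {Ej El} => [] [] [] []; lia.
Qed.

(** With [F = be + ga - 4], the reflection of [n] in [F] replaces [q] by [- 1 - q] and negates both
    bits, while membership depends only on the sign of [q]. *)
Lemma even_odd_symmetric : symmetric_semigroup H.
Proof.
have EF : ((be + ga)%:Z - 4 = 4 * (- 1) + be%:Z * true%:Z + ga%:Z * true%:Z)%R.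
  by lia.
exists ((be + ga)%:Z - 4)%R; last first.
  move=> n; have [q [e1 [e2 ->]]] := even_odd_residue n.
  have -> : ((be + ga)%:Z - 4 - (4 * q + be%:Z * e1%:Z + ga%:Z * e2%:Z) =
    4 * (- 1 - q) + be%:Z * (~~ e1)%:Z + ga%:Z * (~~ e2)%:Z)%R.
    by case: e1 e2 => [] []; lia.
  by rewrite !even_odd_inZ; lia.
split; first by rewrite EF even_odd_inZ.
move=> n; have [q [e1 [e2 ->]]] := even_odd_residue n.
by rewrite even_odd_inZ; case: e1 e2 => [] []; lia.
Qed.

End EvenOdd.

(** The gaps [2 * be - 4] and [ga - 4] enter [H] when any generator is added. Symmetry would make
    [F] the sum of either gap and an element of [H]; as [F] is a gap, both elements are zero, so
    [2 * be = ga], against parity. *)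
Lemma odd_odd_not_symmetric be ga u v c : be = 2 * c + 1 ->
  be + ga = 4 * u -> 0 < u -> be < ga -> ga + 4 * v = 3 * be -> 0 < v ->
  (forall n, H n <-> exists t, n = tdeg 4 be ga t) -> ~ symmetric_semigroup H.
Proof.
move=> Ebe Eu u0 lt Ev v0 HE [F [nF _] sym].
have not_inZ n : (forall i j l, n + 4 != 4 * i.+1 + be * j + ga * l) ->
    ~ inZ H n%:Z.
  move=> nn [n' [<-] /HE [[[i j] l]]]; rewrite /tdeg /= => E.
  by have /eqP := nn i j l; lia.
have nbe : ~ inZ H (2 * be - 4)%:Z.
  apply: not_inZ => i j l; apply/eqP.
  by case: j l => [|[|j]] [|[|l]]; rewrite ?mulnS; lia.
have nga : ~ inZ H (ga - 4)%:Z.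
  apply: not_inZ => i j l; apply/eqP.
  by case: j l => [|[|[|j]]] [|[|l]]; rewrite ?mulnS; lia.
have F_not i j l : F <> (4 * i + be * j + ga * l)%:Z.
  by move=> E; apply: nF; exists (4 * i + be * j + ga * l) => //; apply/HE;
     exists (i, j, l).
have inF n : ~ inZ H n%:Z -> exists t, (F - n%:Z)%R = (tdeg 4 be ga t)%:Z.
  move=> nn; have [|n' -> /HE [t ->]] := (sym (F - n%:Z)%R).2; last by exists t.
  by have -> : (F - (F - n%:Z) = n%:Z)%R by lia.
have [[[i j] l]] := inF _ nbe; have [[[i' j'] l']] := inF _ nga.
rewrite /tdeg /= => E' E.
have Ei : i = 0 by case: i E => // i E; have := F_not i (j + 2) l; lia.
have Ei' : i' = 0 by case: i' E' => // i' E'; have := F_not i' j' (l' + 1); lia.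
subst i i'.
(* The witnesses come from [be + ga = 4 * u], [ga + 4 * v = 3 * be] and, for [l'], from
   [2 * ga = 2 * be + 4 * ((ga - be) %/ 2)]. *)
have El : l = 0.
  by case: l E => // l; rewrite mulnS => E; have := F_not (u - 1) (j + 1) l; lia.
have Ej : j = 0.
  by case: j E => // j; rewrite mulnS => E; have := F_not (v - 1) j (l + 1); lia.
have Ej' : j' = 0.
  by case: j' E' => // j'; rewrite mulnS => E'; have := F_not (u - 1) j' l'; lia.
have El' : l' = 0.
  case: l' E' => // l'; rewrite mulnS => E'.
  by have := F_not ((ga - be) %/ 2 - 1) (j' + 2) l'; lia.
by subst; lia.
Qed.

End Generators.

(** * Contracted valuation ideals *)

Section ValuationIdeal.
Variables (k : fieldType) (n : nat) (a : n.-tuple nat) (h : nat).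
Hypothesis a_gt0 : forall i, (0 < tnth a i)%N.
Hypothesis h_gt0 : (0 < h)%N.
Local Notation J := (fun f : {mpoly k[n]} => is_true ('X^h %| phi a f)).

Lemma dvdX (p : {poly k}) : ('X %| p) = (p.[0] == 0).
Proof. by rewrite -{1}['X]subr0 -polyC0 dvdp_XsubCl. Qed.

Lemma phi_at0 (f : {mpoly k[n]}) : (phi a f).[0] = f@_0%MM.
Proof.
rewrite horner_coef0 (@phi_coef _ _ a f 0 [:: 0%MM]) ?big_seq1 // => m.
rewrite inE; apply/eqP/eqP => [->|/eqP]; first exact: wdeg0.
rewrite /wdeg sum_nat_eq0 => /forallP m0; apply/mnmP => i.
by have := m0 i; rewrite muln_eq0 mnm0E (gtn_eqF (a_gt0 i)) orbF => /eqP.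
Qed.

Lemma dvdXn_at0 (p : {poly k}) : 'X^h %| p -> p.[0] = 0.
Proof. by move=> /dvdXnP p0; rewrite horner_coef0 p0. Qed.

(** If [phi a g] has nonzero constant term it is coprime to [X^h] and cancels; otherwise [X] divides
    it, and the power [h] of [g] lies in [J]. *)
Lemma valuation_ideal_primary : primary_ideal J.
Proof.
split; first exact: dvd_phi_ideal.
  by rewrite phi1 => /dvdXn_at0/eqP; rewrite hornerC oner_eq0.
move=> f g; rewrite phiM => fg.
case: (boolP ((phi a g).[0] == 0)) => g0.
  by right; exists h; rewrite phiXn dvdp_exp2r // dvdX.
left; move: fg; rewrite Gauss_dvdpl // coprimep_expl //.
by rewrite coprimep_sym coprimepX.
Qed.

(** With positive weights, [f] and [phi a f] have the same constant term, and both ideals consist of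
    the [f] for which it is zero. *)
Lemma valuation_ideal_radical :
  same_ideal (radical J) (ideal_span (fun g => exists i, g = 'X_i)).
Proof.
move=> f; split=> [[m]|If].
  rewrite phiXn => /dvdXn_at0/eqP; rewrite horner_exp phi_at0 => f0.
  have {}f0 : f@_0%MM = 0 by move: f0; rewrite expf_eq0 => /andP [_ /eqP].
  have [g ->] := mpoly_const_decomp f; rewrite f0 mpolyC0 add0r.
  apply: ideal_sum; first exact: ideal_spanP.
  move=> i _; rewrite mulrC; case: (ideal_spanP (fun g : {mpoly k[n]} => exists i, g = 'X_i)) => _ _; apply.
  by apply: mem_ideal_span; exists i.
exists h; rewrite phiXn dvdp_exp2r //.
have -> : 'X = 'X^1 :> {poly k} by [].
move: f If; apply: ideal_span_min; first exact: dvd_phi_ideal.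
by move=> _ [i ->]; rewrite phiU dvdp_exp2l.
Qed.

Lemma valuation_ideal_pow i f : ideal_pow J i f -> 'X^(h * i) %| phi a f.
Proof.
elim: i f => [|i IH] f /=; first by rewrite muln0 dvd1p.
move: f; apply: ideal_span_min; first exact: dvd_phi_ideal.
move=> _ [f [g [Jf /IH Jg ->]]].
by rewrite phiM mulnS exprD dvdp_mul.
Qed.

(** Suppose [phi a f] has order at least [v], where [v < h]. Each term [c i * f ^+ (d - i)] has
    order at least [h * i + v * (d - i)], which exceeds [v * d]; hence so does the order of
    [f ^+ d], and [f] gains one more factor. *)
Lemma valuation_ideal_integrally_closed : integrally_closed_ideal J.
Proof.
move=> f [d [c [d0 Jc]]].
move/(congr1 (phi a)); rewrite phiD phi0 phiXn => Ef.
have sum_phi : phi a (\sum_(1 <= i < d.+1) c i * f ^+ (d - i)) =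
    \sum_(1 <= i < d.+1) phi a (c i) * phi a f ^+ (d - i).
  rewrite (big_morph _ (phiD a) (phi0 k a)).
  by apply: eq_bigr => i _; rewrite phiM phiXn.
suff : forall v, (v <= h)%N -> 'X^v %| phi a f by apply.
elim=> [|v IH] vh; first by rewrite expr0 dvd1p.
have /dvdpP [u Eu] := IH (ltnW vh).
suff /(dvdXnP 1) u0 : 'X^1 %| u.
  by rewrite Eu exprS dvdp_mul2r ?expf_neq0 ?polyX_eq0 // -(expr1 'X); apply/dvdXnP.
have : 'X^((v * d).+1) %| phi a f ^+ d.
  move/eqP: Ef; rewrite addr_eq0 => /eqP ->; rewrite dvdpNr sum_phi.
  rewrite big_nat_cond; apply: (big_ind (fun p => 'X^((v * d).+1) %| p)).
  - exact: dvdp0.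
  - by move=> p q pp qq; rewrite dvdp_addr.
  move=> i /andP [/andP [i1 id] _].
  apply: (@dvdp_trans _ ('X^(h * i) * 'X^(v * (d - i)))).
    rewrite -exprD dvdp_exp2l //; have : (i <= d)%N by []; nia.
  apply: dvdp_mul; first by apply/valuation_ideal_pow/Jc; rewrite i1.
  by rewrite exprM dvdp_exp2r // IH // ltnW.
rewrite Eu exprMn -exprM [X in _ %| X]mulrC exprSr dvdp_mul2l ?expf_neq0 ?polyX_eq0 //.
by rewrite !dvdX horner_exp expf_eq0 d0.
Qed.

End ValuationIdeal.

Section Cylinder.
Variables (k : fieldType) (a : 3.-tuple nat) (s : 'S_3).
Local Notation al := (tnth a (s 0)).
Local Notation be := (tnth a (s 1)).
Local Notation x := ('X_(s 0) : {mpoly k[3]}).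
Local Notation y := ('X_(s 1) : {mpoly k[3]}).
Local Notation z := ('X_(s 2%:R) : {mpoly k[3]}).

Lemma mpoly3_decomp (f : {mpoly k[3]}) :
  exists h (g : {mpoly k[2]}), f = h * z + (g \mPo [tuple x; y]).
Proof.
elim/mpoly_ind_XD: f => [c m|f f' [h [g ->]] [h' [g' ->]]]; last first.
  by exists (h + h'), (g + g'); rewrite comp_mpolyD; ring.
have [[[i j] e] ->] := mon_surj s m; rewrite mpolyX_mon /tmon /=.
case: e => [|e].
  exists 0, (c *: ('X_0 ^+ i * 'X_1 ^+ j)).
  rewrite mul0r add0r comp_mpolyZ rmorphM !rmorphXn /= !comp_mpolyXU /=.
  by rewrite mulr1.
exists (c *: (x ^+ i * y ^+ j * z ^+ e)), 0.
by rewrite comp_mpoly0 addr0 -scalerAl exprSr mulrA.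
Qed.

Lemma phi_comp (g : {mpoly k[2]}) :
  phi a (g \mPo [tuple x; y]) = phi [tuple al; be] g.
Proof.
elim/mpoly_ind_XD: g => [c m|f g Ef Eg]; last by rewrite comp_mpolyD !phiD Ef Eg.
rewrite comp_mpolyZ !phiZ comp_mpolyX phiX; congr (_ *: _).
rewrite /wdeg !big_ord_recl !big_ord0 /= mulr1 addn0 phiM !phiXn !phiU.
by rewrite -!exprM -exprD ![(tnth a _ * _)%N]mulnC.
Qed.

End Cylinder.

(** * The classification *)

Lemma F1_gensE (R : comNzRingType) (x y z : R) b d e :
  F1_gens x y z b d e =
  binomial_gens x y z (0, 2, 0)%N (b - d, 0, 1)%N (F1_triples b d e).
Proof. by rewrite /F1_gens /binomial_gens /tmon /= !(expr0, expr1, mul1r, mulr1). Qed.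

Lemma F2_gensE (R : comNzRingType) (x y z : R) b r :
  F2_gens x y z b r =
  binomial_gens x y z (0, 2, 0)%N (2 * b + 1, 0, 0)%N (F2_triples b r).
Proof. by rewrite /F2_gens /binomial_gens /tmon /= !(expr0, expr1, mul1r, mulr1). Qed.

(* The position [s 0] carries the multiplicity; [s] is the renaming of the
   variables in the statement. *)
Definition arranged (H : nat -> Prop) (a : 3.-tuple nat) (s : 'S_3) al be ga :=
  [/\ numerical_semigroup H,
      [/\ tnth a (s 0) = al, tnth a (s 1) = be & tnth a (s 2%:R) = ga],
      [/\ 0 < al, al < be & al < ga]%N
    & forall n, H n <-> exists t, n = tdeg al be ga t].

Lemma arranged_pos H a s al be ga : arranged H a s al be ga ->
  (forall i, 0 < tnth a i)%N /\ (forall i, H (tnth a i)).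
Proof.
case=> _ [Ea Eb Ec] [a0 ab ac] HE; split=> i.
  by case: (ord3_cases s i) => ->; rewrite ?Ea ?Eb ?Ec; lia.
case: (ord3_cases s i) => ->; rewrite ?Ea ?Eb ?Ec; apply/HE;
  [exists (1, 0, 0)%N | exists (0, 1, 0)%N | exists (0, 0, 1)%N];
  rewrite /tdeg /=; lia.
Qed.

Lemma arranged_swap H a s al be ga : arranged H a s al be ga ->
  exists s' : 'S_3, arranged H a s' al ga be.
Proof.
case=> H_sg [Ea Eb Ec] [a0 ab ac] HE.
have [s' [s'0 s'1 s'2]] := swap12 s.
exists s'; split=> //; rewrite ?s'0 ?s'1 ?s'2 // => n.
rewrite HE; split=> [] [[[i j] c] ->]; exists (i, c, j); rewrite /tdeg /=; lia.
Qed.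

Section Arranged.
Variables (k : fieldType) (H : nat -> Prop) (a : 3.-tuple nat) (s : 'S_3).
Variables (al be ga : nat).
Hypothesis arr : arranged H a s al be ga.
Local Notation x := ('X_(s 0) : {mpoly k[3]}).
Local Notation y := ('X_(s 1) : {mpoly k[3]}).
Local Notation z := ('X_(s 2%:R) : {mpoly k[3]}).

Lemma arranged_least l t1 t2 : first_relation al be ga l t1 t2 ->
  least_relation_degree k a l.
Proof.
by case: arr => _ [<- <- <-] _ _; apply: first_relation_least.
Qed.

Lemma arranged_value_ideal l t1 t2 ts : first_relation al be ga l t1 t2 ->
  generating_beyond al be ga l t1 t2 ts ->
  same_ideal (value_ideal a H l.+1) (ideal_of (binomial_gens x y z t1 t2 ts)).
Proof.
have [a0 aH] := arranged_pos arr.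
case: arr => H_sg [<- <- <-] _ _ rel gen.
exact: (value_ideal_binomial_gens H_sg aH a0 rel gen).
Qed.

Lemma arranged_seven l t1 t2 (ts : seq triple) : size ts = 5%N ->
  first_relation al be ga l t1 t2 ->
  generating_beyond al be ga l t1 t2 (tsucc t2 :: ts) ->
  uniq (tsucc t2 :: ts) -> tsucc t1 \notin ts ->
  (forall t, t \in t1 :: ts -> tight al be ga l t) ->
  (forall t, t \in [:: tsucc t1; tsucc t2] ->
     (0 < t.1.2 -> tdeg al be ga t < l + be)%N /\
     (0 < t.2 -> tdeg al be ga t < l + ga)%N) ->
  minimally_generated_by 7 (@value_ideal k 3 a H l.+1).
Proof.
move=> ts5 rel gen t_uniq t1ts ts_tight yz; split.
  exists (binomial_gens x y z t1 t2 (tsucc t2 :: ts)).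
    by rewrite /= size_map ts5.
  exact: arranged_value_ideal.
have [a0 aH] := arranged_pos arr; rewrite -[7%N]/(5.+2) -ts5.
case: arr rel gen ts_tight yz => H_sg [<- <- <-] _ _ rel [gen _] ts_tight yz.
apply: (value_ideal_gens_ge H_sg aH a0 rel) => // t tts.
by apply: gen; rewrite inE tts orbT.
Qed.

Lemma arranged_F1 b d e : al = 3%N \/ al = 4%N ->
  (forall u, be <> al * u)%N -> (forall u, ga <> al * u)%N ->
  (forall u, ga <> be + al * u)%N -> (forall u, 2 * be <> al * u)%N ->
  (be < ga)%N -> (d < b)%N -> (e <= 1)%N -> (ga + al * (b - d) = 2 * be)%N ->
  (al * b < be < al * (b + 1))%N ->
  (al * (2 * b + 1 - e) < 2 * be < al * (2 * b + 2 - e))%N ->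
  least_relation_degree k a (2 * be) /\
  same_ideal (value_ideal a H (2 * be).+1) (ideal_of (F1_gens x y z b d e)).
Proof.
move=> al34 n1 n2 n3 n4 ltbg ltdb e1 eqm bb b2.
have rel := F1_relation al34 n1 n2 n3 n4 ltbg eqm.
split; first exact: arranged_least rel.
by rewrite F1_gensE; apply: arranged_value_ideal rel _; apply: F1_generating.
Qed.

(** Since [z] lies in the ideal, membership is decided modulo [z], that is, by the valuation of
    [k[t]] on polynomials in [x] and [y]. *)
Lemma arranged_cylinder l : (l < ga)%N ->
  exists J : {mpoly k[2]} -> Prop,
    [/\ primary_ideal J, same_ideal (radical J) (ideal_of [:: 'X_0; 'X_1]),
        integrally_closed_ideal J
      & same_ideal (value_ideal a H l.+1)
          (ideal_span (fun f => f = z \/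
             exists2 g, J g & f = g \mPo [tuple x; y]))].
Proof.
move=> lga; have [a0 aH] := arranged_pos arr.
case: arr => H_sg [Ea Eb Ec] [al0 albe _] _.
pose a' := [tuple tnth a (s 0); tnth a (s 1)].
have a'0 i : (0 < tnth a' i)%N.
  by case: i => [[|[|//]] Hi]; rewrite (tnth_nth 0%N) /= a0.
exists (fun f => is_true ('X^(l.+1) %| phi a' f)); split.
- exact: valuation_ideal_primary.
- move=> f; rewrite (valuation_ideal_radical a'0 (ltn0Sn l)).
  split; apply: ideal_span_min; try exact: ideal_spanP.
    move=> _ [i ->]; apply: mem_ideal_span; rewrite !inE.
    by case: i => [[|[|//]] Hi]; apply/orP; [left|right]; apply/eqP;
      congr 'X_[_]; congr mnm1; apply: val_inj.
  by move=> g; rewrite !inE => /orP [] /eqP ->; apply: mem_ideal_span; eexists.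
- exact: valuation_ideal_integrally_closed.
have dvd_z : 'X^(l.+1) %| phi a z by rewrite phiU Ec dvdp_exp2l.
move=> f; rewrite value_idealE //.
set X := fun f => _ \/ _; have X_ideal := ideal_spanP X; split.
  have [h [g ->]] := mpoly3_decomp s f.
  rewrite phiD phiM dvdp_addr ?dvdp_mull // phi_comp => Jg.
  case: X_ideal => _ XD XM; apply: XD.
    by apply: XM; apply: mem_ideal_span; left.
  by apply: mem_ideal_span; right; exists g.
move: f; apply: ideal_span_min; first exact: dvd_phi_ideal.
by move=> _ [->|[g Jg ->]] //; rewrite phi_comp.
Qed.

End Arranged.

Section Classification.
Variables (k : fieldType) (H : nat -> Prop) (a : 3.-tuple nat) (l : nat).
Hypothesis H_semigroup : numerical_semigroup H.
Hypothesis a_gens : minimal_generators H a.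
Hypothesis l_least : least_relation_degree k a l.

Lemma arrange m (P : nat -> nat -> Prop) :
  multiplicity H m ->
  (forall p q, (m < p)%N -> (m < q)%N ->
     (forall u v, p <> m * u + q * v)%N -> (forall u v, q <> m * u + p * v)%N ->
     P p q \/ P q p) ->
  exists s p q, [/\ arranged H a s m p q, (forall u v, p <> m * u + q * v)%N,
    (forall u v, q <> m * u + p * v)%N & P p q].
Proof.
move=> m_mult PP; have [//|s [Ea HE [mp mq] [np nq] Ppq]] :=
  generators_arrangement (P := P) a_gens m_mult.
exists s, (tnth a (s 1)), (tnth a (s 2%:R)); split=> //.
by split=> //; split=> //; case: m_mult.
Qed.

Lemma multiplicity_three : multiplicity H 3 ->
  exists s : 'S_3, exists b d e, [/\ (d < b)%N, (e <= 1)%N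
    & same_ideal (value_ideal a H l.+1)
        (ideal_of (F1_gens ('X_(s 0) : {mpoly k[3]}) 'X_(s 1) 'X_(s 2%:R) b d e))].
Proof.
case/(arrange (P := fun p q => (p < q)%N)).
  by move=> p q _ _ np nq; have := np 0%N 1%N; lia.
move=> s [p [q [arr np nq ltpq]]]; case: (arr) => _ _ [_ lt3p _] _.
(* These instances say that 3 divides neither [p] nor [q], that [q] is not congruent to [p] modulo
   3, and hence that [q] is congruent to [2 * p] and smaller than it. *)
have := np (p %/ 3)%N 0%N; have := nq (q %/ 3)%N 0%N.
have := nq ((q - p) %/ 3)%N 1%N; have := nq ((q - 2 * p) %/ 3)%N 2%N.
move=> h1 h2 h3 h4.
(* The value of [e] records whether [2 * p < 3 * (2 * b + 1)], and [d] solves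
   [q + 3 * (b - d) = 2 * p]. *)
pose b := (p %/ 3)%N; pose e := (p %% 3 == 1)%N : nat.
pose d := (b - (2 * p - q) %/ 3)%N.
have [] // := arranged_F1 k arr (b := b) (d := d) (e := e).
- by left.
- by move=> u; have := np u 0%N; lia.
- by move=> u; have := nq u 0%N; lia.
- by move=> u; have := nq u 1%N; lia.
- by move=> u; lia.
- by rewrite /d /b; lia.
- by rewrite /e; lia.
- by rewrite /d /b; lia.
- by rewrite /b; lia.
- by rewrite /b /e; lia.
move=> least eqI; exists s, b, d, e; rewrite (least_relation_degree_inj l_least least).
by split=> //; rewrite /d /b /e; lia.
Qed.

(** Neither generator is divisible by 4, and they are not congruent modulo 4, as the larger would
    then be redundant. So one is 2 modulo 4 and the other odd, or both are odd with opposite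
    residues. *)
Lemma multiplicity_four : multiplicity H 4 ->
  exists s p q, [/\ arranged H a s 4 p q, (forall u v, p <> 4 * u + q * v)%N,
    (forall u v, q <> 4 * u + p * v)%N, exists c, p = (2 * c + 1)%N
    & (exists b, q = 4 * b + 2)%N \/ (exists u, p + q = 4 * u)%N /\ (p < q)%N].
Proof.
case/(arrange (P := fun p q => (exists c, p = 2 * c + 1)%N /\
  ((exists b, q = 4 * b + 2)%N \/ (exists u, p + q = 4 * u)%N /\ (p < q)%N))).
  move=> p q _ _ np nq.
  have := np (p %/ 4)%N 0%N; have := nq (q %/ 4)%N 0%N.
  have := nq ((q - p) %/ 4)%N 1%N; have := np ((p - q) %/ 4)%N 1%N.
  move=> h1 h2 h3 h4.
  have [h|h] : (p %% 4 = 2 \/ p %% 4 <> 2)%N by lia.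
    right; split; first by exists (q %/ 2)%N; lia.
    by left; exists (p %/ 4)%N; lia.
  have [h'|h'] : (q %% 4 = 2 \/ q %% 4 <> 2)%N by lia.
    left; split; first by exists (p %/ 2)%N; lia.
    by left; exists (q %/ 4)%N; lia.
  have [h''|h''] : (p < q \/ q < p)%N by lia.
    left; split; first by exists (p %/ 2)%N; lia.
    by right; split=> //; exists ((p + q) %/ 4)%N; lia.
  right; split; first by exists (q %/ 2)%N; lia.
  by right; split=> //; exists ((p + q) %/ 4)%N; lia.
by move=> s [p [q [arr np nq [Ep Eq]]]]; exists s, p, q.
Qed.

Lemma multiplicity_four_even_odd s p q : arranged H a s 4 p q ->
  (forall u v, q <> 4 * u + p * v)%N -> (exists c, p = 2 * c + 1)%N ->
  (exists b, q = 4 * b + 2)%N ->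
  symmetric_semigroup H /\
  exists s : 'S_3,
    let x : {mpoly k[3]} := 'X_(s 0) in
    let y : {mpoly k[3]} := 'X_(s 1) in
    let z : {mpoly k[3]} := 'X_(s 2%:R) in
    [\/ exists J : {mpoly k[2]} -> Prop,
          [/\ primary_ideal J,
              same_ideal (radical J) (ideal_of [:: 'X_0; 'X_1]),
              integrally_closed_ideal J
            & same_ideal (value_ideal a H l.+1)
                (ideal_span (fun f => f = z \/
                   exists2 g, J g & f = g \mPo [tuple x; y]))],
        exists b d e : nat,
          [/\ (d < b)%N, (e <= 1)%N
            & same_ideal (value_ideal a H l.+1)
                         (ideal_of (F1_gens x y z b d e))]
      | exists b r : nat,
          [/\ (1 <= b)%N, (1 <= r <= b + 1)%N
            & same_ideal (value_ideal a H l.+1)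
                         (ideal_of (F2_gens x y z b r))]].
Proof.
move=> arr nq [c Ep] [b Eq]; have [s' arr'] := arranged_swap arr.
(* Both [q] and [2 * p] are 2 modulo 4, so [q] would be redundant unless [q < 2 * p]. *)
have := nq ((q - 2 * p) %/ 4)%N 2%N => h.
case: (arr) (arr') => _ _ [_ lt4p lt4q] _ [_ _ _ HE'].
split; first by apply: (even_odd_symmetric Eq Ep) HE'; lia.
case: (ltngtP p q) => [ltpq|ltqp|]; last by lia.
  exists s; apply: Or32.
  pose b' := (p %/ 4)%N; pose e := (p %% 4 == 1)%N : nat.
  pose d := (b' - (2 * p - q) %/ 4)%N.
  have [] // := arranged_F1 k arr (b := b') (d := d) (e := e);
    rewrite /d /b' /e; try lia.
  move=> least eqI; exists b', d, e.
  rewrite (least_relation_degree_inj l_least least).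
  by split=> //; rewrite /d /b' /e; lia.
have rel := F2_relation Eq Ep ltqp.
rewrite (least_relation_degree_inj l_least (arranged_least k arr' rel)).
(* After the exchange [z] has degree [p], so for [2 * q < p] it lies in the ideal itself. *)
exists s'; case: (ltnP (2 * q) p) => [lt|le].
  by apply: Or31; apply: (arranged_cylinder k arr').
apply: Or33; exists b, ((2 * q - p) %/ 4).+1; split; try lia.
rewrite F2_gensE; apply: (arranged_value_ideal arr' rel).
by apply: F2_generating; lia.
Qed.

Lemma multiplicity_four_odd_odd s p q : arranged H a s 4 p q ->
  (forall u v, q <> 4 * u + p * v)%N -> (exists c, p = 2 * c + 1)%N ->
  (exists u, p + q = 4 * u)%N -> (p < q)%N ->
  ~ symmetric_semigroup H /\
  minimally_generated_by 7 (@value_ideal k 3 a H l.+1).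
Proof.
move=> arr nq [c Ep] [u Eu] ltpq.
case: (arr) => _ _ [_ lt4p lt4q] HE.
(* Here [q] and [3 * p] are congruent modulo 4, so [q < 3 * p] and [v] is positive. *)
have := nq ((q - 3 * p) %/ 4)%N 3%N => h.
pose v := ((3 * p - q) %/ 4)%N.
have Ev : (q + 4 * v = 3 * p)%N by rewrite /v; lia.
have v0 : (0 < v)%N by rewrite /v; lia.
have u0 : (0 < u)%N by lia.
split; first exact: odd_odd_not_symmetric Ep Eu u0 ltpq Ev v0 HE.
case: (ltngtP q (2 * p)%N) => [lt|lt|]; last by lia.
  have rel := near_relation Ep lt4p ltpq Eu lt.
  rewrite (least_relation_degree_inj l_least (arranged_least k arr rel)).
  have [nu n1] := near_uniq p q u.
  apply: (arranged_seven k arr (ts := behead (near_triples p q u)) _ rel) => //.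
  - exact: (near_generating Ep lt4p ltpq Eu lt).
  - by move=> t; apply: (near_tight Ep lt4p ltpq Eu).
  - move=> t; rewrite !inE /tdeg => /orP [] /eqP -> /=; lia.
have rel := far_relation Ep lt4p ltpq Eu lt Ev.
rewrite (least_relation_degree_inj l_least (arranged_least k arr rel)).
have [nu n1] := far_uniq p v.
apply: (arranged_seven k arr (ts := behead (far_triples p v)) _ rel) => //.
- exact: (far_generating Ep lt4p ltpq lt Ev).
- by move=> t; apply: (far_tight Ep lt4p ltpq v0 lt Ev).
- move=> t; rewrite !inE /tdeg => /orP [] /eqP -> /=; lia.
Qed.

End Classification.

(** * Realization of all parameters *)

Lemma arranged_tuple (al be ga : nat) N : (0 < al)%N -> (al < be)%N ->
  (al < ga)%N -> be != ga ->
  (forall u v, be <> al * u + ga * v)%N -> (forall u v, ga <> al * u + be * v)%N ->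
  (forall n, N <= n -> exists t, n = tdeg al be ga t)%N ->
  let H := submonoid_span [:: al; be; ga] in let a := [tuple al; be; ga] in
  [/\ numerical_semigroup H, minimal_generators H a, multiplicity H al
    & arranged H a 1%g al be ga].
Proof.
move=> al0 albe alga bega nbe nga cofin H a.
have [H_sg a_min H_mult HE] :=
  tuple_semigroup (erefl H) al0 albe alga bega nbe nga cofin.
by split=> //; split=> //; rewrite !perm1.
Qed.

Lemma F1_realized (k : fieldType) b d e : (d < b)%N -> (e <= 1)%N ->
  exists (H : nat -> Prop) (a : 3.-tuple nat) (l : nat),
    [/\ numerical_semigroup H, minimal_generators H a, multiplicity H 3,
        least_relation_degree k a l
      & exists s : 'S_3, same_ideal (value_ideal a H l.+1)
          (ideal_of (F1_gens ('X_(s 0) : {mpoly k[3]}) 'X_(s 1) 'X_(s 2%:R) b d e))].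
Proof.
(* The number [p] has integer part [b] after division by 3 and the residue prescribed by [e]; [q] is
   then dictated by [q + 3 * (b - d) = 2 * p]. *)
move=> ltdb e1; pose p := (3 * b + 2 - e)%N; pose q := (2 * p - 3 * (b - d))%N.
have lt3p : (3 < p)%N by rewrite /p; lia.
have ltpq : (p < q)%N by rewrite /q /p; lia.
have [|||||||H_sg a_min H_mult arr] := @arranged_tuple 3 p q (2 * p); try lia.
- by move=> u [|v]; [rewrite /p|rewrite mulnS]; lia.
- have lt2p : (q < 2 * p)%N by rewrite /q /p; lia.
  by move=> u [|[|v]]; [rewrite /q /p|rewrite /q /p|rewrite !mulnS]; lia.
- move=> n le; have [h|[h|h]] : (n %% 3 = 0 \/ n %% 3 = p %% 3 \/
      n %% 3 = (2 * p) %% 3)%N by rewrite /p; lia.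
  + by exists (n %/ 3, 0, 0)%N; rewrite /tdeg /=; lia.
  + by exists ((n - p) %/ 3, 1, 0)%N; rewrite /tdeg /=; lia.
  + by exists ((n - 2 * p) %/ 3, 2, 0)%N; rewrite /tdeg /=; lia.
exists (submonoid_span [:: 3; p; q]), [tuple 3; p; q], (2 * p)%N.
have [] // := arranged_F1 k arr (b := b) (d := d) (e := e); rewrite /q /p; try lia.
by move=> least eqI; split=> //; exists 1%g.
Qed.

Lemma F2_realized (k : fieldType) b r : (1 <= b)%N -> (1 <= r <= b + 1)%N ->
  exists (H : nat -> Prop) (a : 3.-tuple nat) (l : nat),
    [/\ numerical_semigroup H /\ minimal_generators H a, multiplicity H 4,
        symmetric_semigroup H, least_relation_degree k a l
      & exists s : 'S_3, same_ideal (value_ideal a H l.+1)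
          (ideal_of (F2_gens ('X_(s 0) : {mpoly k[3]}) 'X_(s 1) 'X_(s 2%:R) b r))].
Proof.
(* This [p] satisfies [4 * (r - 1) + p = 2 * q - 1] and [4 * r + p = 2 * q + 3], so [r] is the least
   exponent taking [x^r z] beyond [2 * q]; the bound [r <= b + 1] gives [q < p]. *)
move=> b1 r1; pose q := (4 * b + 2)%N; pose p := (8 * b + 7 - 4 * r)%N.
have lt4q : (4 < q)%N by rewrite /q; lia.
have ltqp : (q < p)%N by rewrite /q /p; lia.
have Ep : p = (2 * (4 * b + 3 - 2 * r) + 1)%N by rewrite /p; lia.
have [|||||||H_sg a_min H_mult arr] := @arranged_tuple 4 q p (q + p); try lia.
- by move=> u [|v]; [rewrite /q|rewrite mulnS]; lia.
- move=> n le; have [h|[h|[h|h]]] : (n %% 4 = 0 \/ n %% 4 = 2 \/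
      n %% 4 = p %% 4 \/ n %% 4 = (p + 2) %% 4)%N by rewrite /p; lia.
  + by exists (n %/ 4, 0, 0)%N; rewrite /tdeg /=; lia.
  + by exists ((n - q) %/ 4, 1, 0)%N; rewrite /tdeg /=; lia.
  + by exists ((n - p) %/ 4, 0, 1)%N; rewrite /tdeg /=; lia.
  + by exists ((n - q - p) %/ 4, 1, 1)%N; rewrite /tdeg /=; lia.
have rel := F2_relation (erefl q) Ep ltqp.
exists (submonoid_span [:: 4; q; p]), [tuple 4; q; p], (2 * q)%N; split=> //.
- case: arr => _ _ _ HE; apply: (even_odd_symmetric (erefl q) Ep) HE; lia.
- exact: (arranged_least k arr rel).
exists 1%g; rewrite F2_gensE; apply: (arranged_value_ideal arr rel).
by apply: F2_generating; rewrite /q /p; lia.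
Qed.

Theorem theoremB (k : fieldType) :
  (forall (H : nat -> Prop) (a : 3.-tuple nat) (l : nat),
    numerical_semigroup H -> minimal_generators H a ->
    least_relation_degree k a l ->
    [/\ (multiplicity H 3 ->
          exists s : 'S_3,
            let x : {mpoly k[3]} := 'X_(s 0) in
            let y : {mpoly k[3]} := 'X_(s 1) in
            let z : {mpoly k[3]} := 'X_(s 2%:R) in
            exists b d e : nat,
              [/\ (d < b)%N, (e <= 1)%N
                & same_ideal (value_ideal a H l.+1)
                             (ideal_of (F1_gens x y z b d e))]),
        (multiplicity H 4 -> symmetric_semigroup H ->
          exists s : 'S_3,
            let x : {mpoly k[3]} := 'X_(s 0) in
            let y : {mpoly k[3]} := 'X_(s 1) in
            let z : {mpoly k[3]} := 'X_(s 2%:R) in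
            [\/ exists J : {mpoly k[2]} -> Prop,
                  [/\ primary_ideal J,
                      same_ideal (radical J) (ideal_of [:: 'X_0; 'X_1]),
                      integrally_closed_ideal J
                    & same_ideal (value_ideal a H l.+1)
                        (ideal_span (fun f => f = z \/
                           exists2 g, J g & f = g \mPo [tuple x; y]))],
                exists b d e : nat,
                  [/\ (d < b)%N, (e <= 1)%N
                    & same_ideal (value_ideal a H l.+1)
                                 (ideal_of (F1_gens x y z b d e))]
              | exists b r : nat,
                  [/\ (1 <= b)%N, (1 <= r <= b + 1)%N
                    & same_ideal (value_ideal a H l.+1)
                                 (ideal_of (F2_gens x y z b r))]])
      & (multiplicity H 4 -> ~ symmetric_semigroup H ->
          minimally_generated_by 7 (@value_ideal k 3 a H l.+1))]) /\
  (forall b d e : nat, (d < b)%N -> (e <= 1)%N ->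
    exists (H : nat -> Prop) (a : 3.-tuple nat) (l : nat),
      [/\ numerical_semigroup H, minimal_generators H a, multiplicity H 3,
          least_relation_degree k a l
        & exists s : 'S_3,
            let x : {mpoly k[3]} := 'X_(s 0) in
            let y : {mpoly k[3]} := 'X_(s 1) in
            let z : {mpoly k[3]} := 'X_(s 2%:R) in
            same_ideal (value_ideal a H l.+1)
                       (ideal_of (F1_gens x y z b d e))]) /\
  (forall b r : nat, (1 <= b)%N -> (1 <= r <= b + 1)%N ->
    exists (H : nat -> Prop) (a : 3.-tuple nat) (l : nat),
      [/\ numerical_semigroup H /\ minimal_generators H a,
          multiplicity H 4, symmetric_semigroup H,
          least_relation_degree k a l
        & exists s : 'S_3,
            let x : {mpoly k[3]} := 'X_(s 0) in
            let y : {mpoly k[3]} := 'X_(s 1) in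
            let z : {mpoly k[3]} := 'X_(s 2%:R) in
            same_ideal (value_ideal a H l.+1)
                       (ideal_of (F2_gens x y z b r))]).
Proof.
split; last by split=> [b d e|b r]; [apply: F1_realized|apply: F2_realized].
move=> H a l H_sg a_min l_least; split; first exact: multiplicity_three.
(* The residues of the generators decide symmetry, so the case that disagrees with the assumption is
   contradictory. *)
- move=> /(multiplicity_four H_sg a_min) [s [p [q [arr _ nq odd_p [even_q|[odd_q ltpq]]]]]] sym.
    by have [] := multiplicity_four_even_odd l_least arr nq odd_p even_q.
  by have [] := multiplicity_four_odd_odd l_least arr nq odd_p odd_q ltpq.
- move=> /(multiplicity_four H_sg a_min) [s [p [q [arr _ nq odd_p [even_q|[odd_q ltpq]]]]]] nsym.
    by have [] := multiplicity_four_even_odd l_least arr nq odd_p even_q.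
  by have [] := multiplicity_four_odd_odd l_least arr nq odd_p odd_q ltpq.
Qed.
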